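(* For every $d\geq 3$ there is a contractible but non-collapsible simplicial $d$-complex that has two distinct optimal discrete Morse vectors $(1,0,\dots,0,1,1,0)$ and $(1,0,\dots,0,0,1,1)$ (vectors of length $d+1$).
   Context: A simplicial complex is collapsible if it can be reduced to a single vertex by elementary collapses (each removing a face $\sigma$ properly contained in exactly one other face $\tau$, together with $\tau$). A discrete Morse function is meant in the sense of Forman; its discrete Morse vector is $(c_0,\dots,c_d)$ where $c_i$ is the number of critical $i$-dimensional faces. A discrete Morse vector is optimal if it minimizes the total number $c_0+\dots+c_d$ of critical faces among all discrete Morse functions on the complex. *)

(* Defs.v *)
From HB Require Import structures.
From mathcomp Require Import all_boot all_order all_algebra.
Import Order.TTheory GRing.Theory Num.Theory.

Set Implicit Arguments.
Unset Strict Implicit.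
Unset Printing Implicit Defensive.

Local Open Scope ring_scope.

Section SimplicialComplexes.

Variable V : finType.

Implicit Types (sigma tau rho : {set V}) (K L : {set {set V}}).

(* Finite abstract complexes.  The empty set is not a face, so it takes part
   neither in collapses nor in discrete Morse functions.  Elements of [V]
   that are not vertices of [K] are allowed. *)
Definition simplicial_complex K : Prop :=
  set0 \notin K /\
  (forall sigma tau, sigma \in K -> tau \subset sigma -> tau != set0 ->
     tau \in K).

Definition face_dim sigma : nat := #|sigma|.-1.

Definition complex_dim K : nat := \max_(sigma in K) face_dim sigma.

Definition elementary_collapse K L : bool :=
  [exists sigma in K, exists tau in K,
     ([set rho in K | sigma \proper rho] == [set tau])
     && (L == K :\: [set sigma; tau])].

Definition collapsible K : Prop :=
  exists v : V, connect elementary_collapse K [set [set v]].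

Variable R : realDomainType.

Definition is_facet rho tau : bool :=
  (rho \subset tau) && (#|tau| == #|rho|.+1).

Definition upper_exceptions K (f : {set V} -> R) sigma : {set {set V}} :=
  [set tau in K | is_facet sigma tau && (f tau <= f sigma)].

Definition lower_exceptions K (f : {set V} -> R) sigma : {set {set V}} :=
  [set rho in K | is_facet rho sigma && (f sigma <= f rho)].

(* Forman's definition; only the values of [f] on the faces of [K] matter. *)
Definition discrete_morse K (f : {set V} -> R) : Prop :=
  forall sigma, sigma \in K ->
    (#|upper_exceptions K f sigma| <= 1)%N /\
    (#|lower_exceptions K f sigma| <= 1)%N.

Definition critical_faces K (f : {set V} -> R) : {set {set V}} :=
  [set sigma in K | (upper_exceptions K f sigma == set0)
                    && (lower_exceptions K f sigma == set0)].

Definition morse_vector K (f : {set V} -> R) : seq nat :=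
  [seq #|[set sigma in critical_faces K f | face_dim sigma == i]|
     | i <- iota 0 (complex_dim K).+1].

Definition optimal_morse_vector K (c : seq nat) : Prop :=
  exists f : {set V} -> R,
    [/\ discrete_morse K f, morse_vector K f = c
      & forall g : {set V} -> R, discrete_morse K g ->
          (#|critical_faces K f| <= #|critical_faces K g|)%N].

End SimplicialComplexes.

Arguments optimal_morse_vector {V} R K c.

(* Imported only here because [classical_sets] shadows [finset.set0]. *)
From mathcomp Require Import all_classical all_reals all_analysis.
Import numFieldNormedType.Exports.
Local Open Scope classical_set_scope.

(* Barycentric coordinates, as a subspace of the finite product [R ^ V]. *)
Definition realization (V : finType) (R : realType) (K : {set {set V}}) :
    set {ptws V -> R} :=
  [set x | [/\ forall v, 0 <= x v, \sum_v x v = 1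
             & [set v | x v != 0]%SET \in K]].

Arguments realization {V} R K _.

Definition contractible (R : realType) (T : topologicalType) (A : set T) :
    Prop :=
  exists (a : T) (H : T * R -> T),
    [/\ A a,
        {within A `*` `[0, 1], continuous H},
        forall x t, A x -> 0 <= t <= 1 -> A (H (x, t)),
        forall x, A x -> H (x, 0) = x
      & forall x, A x -> H (x, 1) = a].

(* (1, 0, ..., 0, 1, 1, 0) and (1, 0, ..., 0, 0, 1, 1); both have length
   [d.+1] when [3 <= d]. *)
Definition vector110 (d : nat) : seq nat :=
  1%N :: nseq (d - 3) 0%N ++ [:: 1; 1; 0]%N.

Definition vector011 (d : nat) : seq nat :=
  1%N :: nseq (d - 3) 0%N ++ [:: 0; 1; 1]%N.

(* Main.v *)
(** For a vertex [v] of a complex and a set [W] of new vertices, the wedge is the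
    complex of all nonempty [w] such that [code w], which consists of the vertices of
    [w] outside [W] and of [v] if [W] is contained in [w], is empty or a face. It has
    [#|W|.-1] more dimensions, a collapse lifts to a collapse, and a critical face to
    a critical face.  So the Morse vectors come from an explicit 3-complex
    [F + C1 + C2 + X].

    [F] is a tetrahedron with one free facet [t], its other facets lying in the
    branched pieces [C1] and [C2], which have no free faces besides them; [X] is a
    collapsible 2-complex containing [t] whose only free edge [e] is an edge of [F],
    common to two facets lying in [C1] and in [C2].  Collapsing through [t] empties
    [F], [C1] and [C2] and leaves membranes closing up [e]: one critical face breaks
    them, [e] becomes free and [X] without [t] collapses onto a sphere.  If the
    interior of [F] is made critical instead, then [t] survives, and after the
    membranes are broken all of [X] collapses.

    Its wedges do not collapse: [F] can only be entered through [t], and then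
    [C1] and [C2] always contain chains with the same boundaries modulo 2 as the facets
    of [F] to which they are attached.  These chains keep every ridge of [X] from being
    free.

    The number of critical faces of a Morse function is congruent to the number of
    faces modulo 2, and is 1 only on a collapsible complex, so 3 is optimal.
    For contractibility, attach a cone over [F + C1 + C2]: the result collapses both to
    a point and onto the original complex. *)

Require Import Defs.
From mathcomp Require Import all_boot all_order all_algebra.
From mathcomp Require Import zify.
Import Order.TTheory GRing.Theory Num.Theory.

Set Implicit Arguments.
Unset Strict Implicit.
Unset Printing Implicit Defensive.

(** * Collapses *)

Section Collapses.

Variable V : finType.
Implicit Types (s t r : {set V}) (K L M : {set {set V}}).

Lemma elementary_collapseP K L :
  reflect (exists s t, [/\ s \in K, t \in K,
             [set r in K | s \proper r] = [set t] & L = K :\: [set s; t]])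
          (elementary_collapse K L).
Proof.
apply: (iffP 'exists_andP) => [[s [Ks /'exists_andP [t [Kt /andP[/eqP e /eqP ->]]]]]|].
  by exists s, t.
move=> [s [t [Ks Kt e ->]]]; exists s; split=> //.
by apply/'exists_andP; exists t; split=> //; rewrite e !eqxx.
Qed.

Lemma free_faceP K s t : [set r in K | s \proper r] = [set t] ->
  [/\ t \in K, s \proper t & forall r, r \in K -> s \proper r -> r = t].
Proof.
move/setP=> e; have := e t; rewrite !inE eqxx => /andP[Kt st].
by split=> // r Kr sr; have := e r; rewrite !inE Kr sr => /esym/eqP.
Qed.

(** Any vertex [x] of [t] outside [s] already gives a coface [x |: s] inside [t], which is [t] by
    uniqueness. *)
Lemma free_face_card K s t : simplicial_complex K -> s \in K ->
  [set r in K | s \proper r] = [set t] -> #|t| = #|s|.+1.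
Proof.
move=> [_ down] Ks /free_faceP[Kt]; rewrite properE => /andP[st /subsetPn[x tx sx]] u.
suff <- : x |: s = t by rewrite cardsU1 sx.
have xst : x |: s \subset t by rewrite subUset sub1set tx.
apply: u; first by apply: down Kt xst _; apply/set0Pn; exists x; rewrite !inE eqxx.
by rewrite properE subsetUr; apply/subsetPn; exists x => //; rewrite !inE eqxx.
Qed.

Lemma upclosed_complex K M : simplicial_complex K ->
  (forall s t, s \in M -> t \in K -> s \subset t -> t \in M) ->
  simplicial_complex (K :\: M).
Proof.
move=> [n0 down] up; split=> [|s t]; first by rewrite inE (negbTE n0) andbF.
rewrite !inE => /andP[sM sK] ts t0; rewrite (down _ _ sK ts t0) andbT.
by apply: contra sM => tM; apply: up tM sK ts.
Qed.

Lemma free_pair_upclosed K s t : [set r in K | s \proper r] = [set t] ->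
  forall r r', r \in [set s; t] -> r' \in K -> r \subset r' -> r' \in [set s; t].
Proof.
move=> /free_faceP[Kt st u] r r'; rewrite !inE => /orP[]/eqP-> Kr' rr'.
  have [//|ne] := eqVneq r' s.
  by rewrite (u r') ?eqxx ?orbT // properEneq eq_sym ne.
by rewrite (u r') ?eqxx ?orbT //; apply: proper_sub_trans st rr'.
Qed.

Lemma elementary_collapse_complex K L :
  simplicial_complex K -> elementary_collapse K L -> simplicial_complex L.
Proof.
move=> cK /elementary_collapseP[s [t [Ks Kt e ->]]].
exact/upclosed_complex/free_pair_upclosed.
Qed.

Lemma connect_complex K L : simplicial_complex K ->
  connect (@elementary_collapse V) K L -> simplicial_complex L.
Proof.
move=> cK /connectP[p]; elim: p K cK => [|L' p IH] K cK /= => [_ -> //|].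
by case/andP=> /(elementary_collapse_complex cK) /IH; apply.
Qed.

(* Among the faces of [M] missing [x], one of maximal cardinality is free: its
   cofaces lie in [M], and removing [x] from one of them gives it back. *)
Lemma toggle_collapse K M x : M \subset K ->
  (forall s t, s \in M -> t \in K -> s \subset t -> t \in M) ->
  (forall s, s \in M -> x |: s \in M /\ s :\ x \in M) ->
  connect (@elementary_collapse V) K (K :\: M).
Proof.
have D1 r : x \notin r -> r :\ x = r.
  by move=> xr; apply/setDidPl; rewrite disjoint_sym disjoints1.
have [n] := ubnP #|M|; elim: n K M => // n IH K M leM MK up tog.
have [->|[s0 Ms0]] := set_0Vmem M; first by rewrite setD0 connect0.
pose P := [pred s | (s \in M) && (x \notin s)].
have P0 : P (s0 :\ x) by rewrite /= (tog _ Ms0).2 !inE eqxx.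
case: (@arg_maxnP _ _ P (fun s => #|s|) P0) => s /andP[Ms xs] smax.
pose t := x |: s; have Mt : t \in M by apply: (tog _ Ms).1.
have free : [set r in K | s \proper r] = [set t].
  apply/setP=> r; rewrite !inE; apply/andP/eqP => [[Kr sr]|->]; last first.
    split; first exact: (subsetP MK).
    by rewrite properE subsetUr; apply/subsetPn; exists x; rewrite ?inE ?eqxx.
  have Mr : r \in M by apply: up Ms Kr (proper_sub sr).
  have srx : s \subset r :\ x by rewrite subsetD1 (proper_sub sr).
  have /eqP es : s == r :\ x.
    by rewrite eqEcard srx; apply: smax; rewrite /= (tog _ Mr).2 !inE eqxx.
  rewrite /t es setD1K //; apply: contraTT sr => xr.
  by rewrite es D1 // properxx.
apply: connect_trans (connect1 _) _.
  by apply/elementary_collapseP; exists s, t; split=> //; apply: (subsetP MK).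
have -> : K :\: M = (K :\: [set s; t]) :\: (M :\: [set s; t]).
  apply/setP=> r; rewrite !inE; case: (boolP (r \in M)) => Mr /=.
    by rewrite andbT; case: (_ || _).
  rewrite andbF /=; case: eqP => [e|_] /=; first by rewrite e Ms in Mr.
  by case: eqP => [e|//] /=; rewrite e Mt in Mr.
apply: IH.
- have : M :\: [set s; t] \proper M.
    rewrite properE subsetDl; apply/subsetPn; exists s => //.
    by rewrite !inE eqxx.
  by move/proper_card; lia.
- by rewrite setSD.
- move=> r r' /setDP[Mr nr] /setDP[Kr' nr'] rr'.
  by rewrite !inE; rewrite !inE in nr'; rewrite nr'; apply: up Mr Kr' rr'.
- move=> r /setDP[Mr]; rewrite !inE negb_or => /andP[rs rt].
  have [Mx Mx'] := tog _ Mr; rewrite Mx Mx' !negb_or !andbT.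
  have xt : t :\ x = s by rewrite setU1K.
  split; apply/andP; split.
  + by apply: contraNneq xs => <-; rewrite setU11.
  + apply/eqP=> e; have [xr|xr] := boolP (x \in r).
      by move: rt; rewrite -e (setUidPr _) ?sub1set ?eqxx.
    by move: rs; rewrite -xt -e setU1K ?eqxx.
  + apply/eqP=> e; have [xr|xr] := boolP (x \in r).
      by move: rt; rewrite /t -e setD1K ?eqxx.
    by move: rs; rewrite -e D1 ?eqxx.
  + by apply/eqP=> e; have := setU11 x s; rewrite -/t -e !inE eqxx.
Qed.

(** This is the form of a collapse from which the linear retraction [push] is built: the larger face
    adds one vertex [v], and [i0] witnesses that [s] is nonempty. *)
Lemma elementary_collapse_vertex K L : simplicial_complex K -> elementary_collapse K L ->
  exists s i0 v, [/\ i0 \in s, v \notin s, v |: s \in K,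
    forall r : {set V}, r \in K -> s \subset r -> r = s \/ r = v |: s & L = K :\: [set s; v |: s]].
Proof.
move=> cK /elementary_collapseP[s [t [Ks Kt free ->]]].
have ct := free_face_card cK Ks free; have [_ st u] := free_faceP free.
have /subsetPn[v tv sv] := proper_subn st.
have et : t = v |: s.
  apply/eqP; rewrite eq_sym eqEcard subUset sub1set tv proper_sub //=.
  by rewrite cardsU1 sv ct.
have /set0Pn[i0 si0] : s != set0 by apply: contraTneq Ks => ->; case: cK.
exists s, i0, v; split=> //; rewrite -et //.
move=> r Kr sr; have [->|ns] := eqVneq r s; first by left.
by right; apply: u => //; rewrite properEneq eq_sym ns.
Qed.

End Collapses.

(** * Discrete Morse functions *)

Section MorseFunctions.

Variables (V : finType) (R : realDomainType).
Implicit Types (s t r : {set V}) (K L C D : {set {set V}}) (f : {set V} -> R).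

(** Natural values below a strict bound [N] leave room to extend the function to new faces by the
    value [N]. *)
Definition has_critical_set K C : Prop :=
  exists (N : nat) (h : {set V} -> nat),
    let f s : R := (h s)%:R%R in
    [/\ forall s, s \in K -> h s < N, discrete_morse K f & critical_faces K f = C].

Lemma has_critical_set_empty : has_critical_set set0 set0.
Proof.
exists 0, (fun=> 0); split=> [s|s|]; rewrite ?inE //.
by apply/setP=> s; rewrite !inE.
Qed.

Lemma facet_proper r t : is_facet r t -> r \proper t.
Proof. by case/andP=> rt /eqP c; rewrite properEcard rt c ltnSn. Qed.

(* Both ways of adding faces to [L] give the new faces the value [N], larger
   than all the values on [L]. *)
Lemma add_critical_set K L C D :
  L \subset K ->
  (forall s t, s \in K -> s \notin L -> t \in L -> ~~ (s \proper t)) ->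
  (forall s, s \in K -> s \notin L -> [/\
     #|[set t in K | (t \notin L) && is_facet s t]| <= 1,
     #|[set r in K | (r \notin L) && is_facet r s]| <= 1 &
     (s \in D) = ([set t in K | (t \notin L) && is_facet s t] == set0) &&
                 ([set r in K | (r \notin L) && is_facet r s] == set0)]) ->
  D \subset K -> [disjoint D & L] ->
  has_critical_set L C -> has_critical_set K (D :|: C).
Proof.
move=> LK up loc DK DL [N [h /= [hN mL cL]]].
pose g s := if s \in L then h s else N.
have Kf s t : s \in K -> is_facet s t -> t \in L -> s \in L.
  move=> Ks st tL; apply: contraT => sL.
  by have := up s t Ks sL tL; rewrite facet_proper.
have upL s : s \in L ->
    upper_exceptions K (fun s => (g s)%:R%R : R) s =
    upper_exceptions L (fun s => (h s)%:R%R : R) s.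
  move=> sL; apply/setP=> t; rewrite !inE !ler_nat /g sL.
  have [tL|tL] := boolP (t \in L); first by rewrite (subsetP LK).
  by rewrite leqNgt hN // !andbF.
have loL s : s \in L ->
    lower_exceptions K (fun s => (g s)%:R%R : R) s =
    lower_exceptions L (fun s => (h s)%:R%R : R) s.
  move=> sL; apply/setP=> t; rewrite !inE !ler_nat /g sL.
  have [tL|tL] := boolP (t \in L); first by rewrite (subsetP LK).
  apply/negP=> /andP[Kt /andP[ts _]]; case/negP: tL; exact: Kf Kt ts sL.
have upN s : s \notin L ->
    upper_exceptions K (fun s => (g s)%:R%R : R) s =
    [set t in K | (t \notin L) && is_facet s t] :|:
    [set t in K | [&& t \in L, is_facet s t & h t <= N]].
  move=> sL; apply/setP=> t; rewrite !inE !ler_nat /g (negbTE sL).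
  by case: (t \in K) => //=; case: (t \in L); rewrite /= ?orbF ?leqnn ?andbT ?andTb.
have loN s : s \notin L ->
    lower_exceptions K (fun s => (g s)%:R%R : R) s =
    [set r in K | (r \notin L) && is_facet r s].
  move=> sL; apply/setP=> t; rewrite !inE !ler_nat /g (negbTE sL).
  case: (t \in K) => //=; case: (boolP (t \in L)) => tL; rewrite /= ?leqnn ?andbT //.
  by rewrite leqNgt hN ?andbF.
(* No face of [L] has a new face as a facet, so the second part of the union is empty. *)
have upN' s : s \in K -> s \notin L ->
    upper_exceptions K (fun s => (g s)%:R%R : R) s =
    [set t in K | (t \notin L) && is_facet s t].
  move=> Ks sL; rewrite upN //; apply/setUidPl/subsetP=> t; rewrite !inE.
  move=> /and4P[Kt tL st _]; case/negP: sL; exact: Kf Ks st tL.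
exists N.+1, g; split=> [s Ks|s Ks|].
- by rewrite /g; case: ifP => // sL; apply: leqW; apply: hN.
- have [sL|sL] := boolP (s \in L); first by rewrite upL // loL //; apply: mL.
  by rewrite upN' // loN //; have [] := loc s Ks sL.
- apply/setP=> s; rewrite -cL inE; have [sL|sL] := boolP (s \in L).
    rewrite upL // loL // (subsetP LK) //= !inE sL /=.
    by have /negbTE-> : s \notin D by apply: contraTN sL => sD; rewrite (disjointFr DL).
  rewrite !inE (negbTE sL) /= orbF.
  have [Ks|Ks] := boolP (s \in K); last first.
    by apply/esym/negbTE; apply: contra Ks; apply: (subsetP DK).
  by rewrite upN' // loN //=; have [_ _ ->] := loc s Ks sL.
Qed.

Lemma add_critical_face K t C : t \in K ->
  (forall r, r \in K -> t \subset r -> r = t) ->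
  has_critical_set (K :\ t) C -> has_critical_set K (t |: C).
Proof.
move=> Kt tmax; apply: add_critical_set.
- exact: subsetDl.
- move=> s r Ks; rewrite !inE Ks andbT negbK => /eqP-> /andP[rt Kr].
  by apply: contraNN rt => /proper_sub /tmax ->.
- move=> s Ks; rewrite !inE Ks andbT negbK => /eqP->; rewrite eqxx.
  have e (P : {set V} -> bool) : P t = false ->
      [set r in K | (r \notin K :\ t) && P r] = set0.
    move=> Pt; apply/setP=> r; rewrite !inE negb_and negbK.
    by case: eqP => [->|_] /=; rewrite ?Pt ?andbF //; case: (r \in K).
  have ft : is_facet t t = false by rewrite /is_facet subxx; lia.
  by rewrite (e (is_facet t)) // (e (fun q => is_facet q t)) // cards0 eqxx.
- by rewrite sub1set.
- by rewrite disjoints1 !inE eqxx.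
Qed.

(** Both faces of the pair get the same value, so each is the only exception of the other and
    neither is critical; the set [D] of new critical faces is empty. *)
Lemma add_free_pair K L C : simplicial_complex K -> elementary_collapse K L ->
  has_critical_set L C -> has_critical_set K C.
Proof.
move=> cK /elementary_collapseP[s [t [Ks Kt e ->]]].
have ct := free_face_card cK Ks e; have [_ st u] := free_faceP e.
have nst : s != t by apply: contraTneq st => ->; rewrite properxx.
rewrite -{2}[C]set0U; apply: add_critical_set.
- exact: subsetDl.
- move=> r r' Kr; rewrite inE Kr andbT negbK => rst; rewrite inE => /andP[r'st Kr'].
  by apply: contraNN r'st => /proper_sub; apply: (free_pair_upclosed e).
- move=> r Kr; rewrite [r \in _]inE Kr andbT negbK inE.
  have eP (P : {set V} -> bool) :
     [set q in K | (q \notin K :\: [set s; t]) && P q] = [set q in [set s; t] | P q].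
    apply/setP=> q; rewrite !inE; have [Kq|Kq] := boolP (q \in K).
      by rewrite andbT negbK.
    have /negbTE-> : q != s by apply: contraNneq Kq => ->.
    by have /negbTE-> : q != t by apply: contraNneq Kq => ->.
  rewrite (eP (is_facet r)) (eP (fun q => is_facet q r)) !inE.
  have fss q : is_facet q q = false by rewrite /is_facet subxx; lia.
  have fst : is_facet s t by rewrite /is_facet (proper_sub st) ct eqxx.
  have fts : is_facet t s = false by rewrite /is_facet ct; lia.
  have sub1 (P : {set V} -> bool) q q' : P q -> P q' = false ->
     [set x in [set q; q'] | P x] = [set q].
    move=> Pq Pq'; apply/setP=> x; rewrite !inE; case: eqP => [->|_] //=.
    by case: eqP => [->|_].
  have sub0 (P : {set V} -> bool) q q' : P q = false -> P q' = false ->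
     [set x in [set q; q'] | P x] = set0.
    move=> Pq Pq'; apply/setP=> x; rewrite !inE; case: eqP => [->|_] //=.
    by case: eqP => [->|_].
  have n0 q : ([set q] == set0 :> {set {set V}}) = false.
    by apply/negbTE/set0Pn; exists q; rewrite inE.
  move=> /orP[]/eqP->.
    rewrite setUC (sub1 (is_facet s)) // setUC (sub0 (fun q => is_facet q s)) //.
    by rewrite cards1 cards0 n0.
  rewrite (sub0 (is_facet t)) // (sub1 (fun q => is_facet q t)) //.
  by rewrite cards1 cards0 n0 andbF.
- exact: sub0set.
- by rewrite -setI_eq0 set0I.
Qed.

Lemma connect_critical_set K L C : simplicial_complex K ->
  connect (@elementary_collapse V) K L ->
  has_critical_set L C -> has_critical_set K C.
Proof.
move=> cK /connectP[p]; elim: p K cK => [|L' p IH] K cK /= => [_ -> //|].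
case/andP=> KL' pp eL hL; apply: (add_free_pair cK KL').
exact: IH (elementary_collapse_complex cK KL') pp eL hL.
Qed.

End MorseFunctions.

(** * Lower bound for the number of critical faces *)

Section LowerBound.

Variables (V : finType) (R : realDomainType).
Implicit Types (s t r : {set V}) (K L C : {set {set V}}) (f g : {set V} -> R).

Lemma card_le1_eq (T : finType) (A : {set T}) x y :
  #|A| <= 1 -> x \in A -> y \in A -> x = y.
Proof. by move=> /card_le1_eqP h xA yA; apply: h. Qed.

(* Forman's lemma: the diamond [r < s, s' < t] would give
   [f s' < f t <= f s <= f r < f s']. *)
Lemma exceptions_exclusive K f s : simplicial_complex K -> discrete_morse K f ->
  s \in K -> upper_exceptions K f s != set0 -> lower_exceptions K f s = set0.
Proof.
move=> [n0 down] dm Ks /set0Pn[t]; rewrite inE => /and3P[Kt /andP[st /eqP ct] fts].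
apply/eqP; apply: contraT => /set0Pn[r]; rewrite inE.
move=> /and3P[Kr /andP[rs /eqP cs] fsr].
pose s' := r :|: (t :\: s).
have ts1 : #|t :\: s| = 1 by rewrite cardsD (setIidPr st); lia.
have r0 : r != set0 by apply: contraNneq n0 => <-.
have dr : r :&: (t :\: s) = set0.
  apply/setP=> x; rewrite !inE; case: (boolP (x \in r)) => //= xr.
  by rewrite (subsetP rs x xr).
have cs' : #|s'| = #|r|.+1 by rewrite cardsU dr cards0 ts1 addn1 subn0.
have rt : r \subset t := subset_trans rs st.
have s't : s' \subset t by rewrite subUset rt subsetDl.
have Ks' : s' \in K.
  apply: down Kt s't _; case/set0Pn: r0 => x xr.
  by apply/set0Pn; exists x; rewrite inE xr.
have nss' : s' != s.
  have /eqP/cards1P[x ex] := ts1; apply/eqP=> /setP/(_ x).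
  have : x \in t :\: s by rewrite ex set11.
  by rewrite !inE => /andP[/negbTE-> ->]; rewrite orbT.
have [ur lt] := ((dm r Kr).1, (dm t Kt).2).
have h1 : (f r < f s')%R.
  rewrite ltNge; apply: contraNN nss' => h; apply/eqP.
  apply: (card_le1_eq ur); rewrite inE ?Ks' ?Ks /is_facet ?rs ?subsetUl ?cs ?cs' ?eqxx //=.
have h2 : (f s' < f t)%R.
  rewrite ltNge; apply: contraNN nss' => h; apply/eqP.
  apply: (card_le1_eq lt); rewrite inE ?Ks' ?Ks /is_facet ?st ?s't ?ct ?cs' ?cs ?eqxx //=.
have := lt_le_trans h2 (le_trans fts (le_trans fsr (ltW h1))).
by rewrite ltxx.
Qed.

(** Exceptional pairs match the faces having an upper exception with those having a lower one, and
    no face is of both kinds; so the non-critical faces are even in number. *)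
Lemma critical_card_parity K f : simplicial_complex K -> discrete_morse K f ->
  odd #|critical_faces K f| = odd #|K|.
Proof.
move=> cK dm.
pose U := [set s in K | upper_exceptions K f s != set0].
pose L := [set s in K | lower_exceptions K f s != set0].
have count (E : {set V} -> {set {set V}}) : (forall s, s \in K -> #|E s| <= 1) ->
    #|[set s in K | E s != set0]| = \sum_(s in K) #|E s|.
  move=> E1; rewrite -sum1_card [RHS](bigID (fun s => E s == set0)) /=.
  rewrite [X in _ = X + _]big1 => [|s /andP[_ /eqP->]]; last by rewrite cards0.
  rewrite add0n; apply: eq_big => [s|s]; rewrite ?inE // => /andP[Ks Es].
  by apply/eqP; rewrite eq_sym eqn_leq E1 // card_gt0 Es.
have UL : #|U| = #|L|.
  rewrite !count => [|s Ks|s Ks]; [|by case: (dm s Ks)|by case: (dm s Ks)].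
  (* Both cardinals count the pairs of a face and a facet of it on which [f] fails to increase. *)
  transitivity (\sum_(s in K) \sum_(t in K) (is_facet s t && (f t <= f s)%R : nat)).
    by apply: eq_bigr => s Ks; rewrite -sum1_card big_mkcond [RHS]big_mkcond;
       apply: eq_bigr => t _; rewrite inE; case: (t \in K) => //=; case: (_ && _).
  rewrite exchange_big; apply: eq_bigr => t Kt.
  by rewrite -[RHS]sum1_card big_mkcond [RHS]big_mkcond;
     apply: eq_bigr => s _; rewrite inE; case: (s \in K) => //=; case: (_ && _).
have dUL : [disjoint U & L].
  rewrite -setI_eq0; apply/eqP/setP=> s; rewrite !inE; apply/negP.
  case/andP=> /andP[Ks us] /andP[_ /negP]; apply.
  by rewrite (exceptions_exclusive cK dm Ks us).
have -> : K = critical_faces K f :|: (U :|: L).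
  apply/setP=> s; rewrite !inE; case: (s \in K) => //=.
  by case: (upper_exceptions K f s == set0); case: (lower_exceptions K f s == set0).
(* The decomposition of [K] was also substituted inside [critical_faces]; this folds it back
   there. *)
have -> : critical_faces (critical_faces K f :|: (U :|: L)) f = critical_faces K f.
  congr (critical_faces _ f); apply/setP=> s; rewrite !inE; case: (s \in K) => //=.
  by case: (upper_exceptions K f s == set0); case: (lower_exceptions K f s == set0).
rewrite cardsU (_ : critical_faces K f :&: _ = set0) ?cards0 ?subn0.
  rewrite cardsU (_ : U :&: L = set0); last by apply/eqP; rewrite setI_eq0.
  by rewrite cards0 subn0 UL !oddD addbb addbF.
apply/setP=> s; rewrite !inE; case: (s \in K) => //=.
by case: (upper_exceptions K f s == set0); case: (lower_exceptions K f s == set0).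
Qed.

(** A vertex of least value is critical: an edge with a value no larger would have both its ends as
    lower exceptions, and the empty set is not a face. *)
Lemma min_vertex_critical K f : simplicial_complex K -> discrete_morse K f ->
  K != set0 -> exists v, [set v] \in critical_faces K f.
Proof.
move=> [n0 down] dm /set0Pn[s0 Ks0].
have /set0Pn[v0 sv0] : s0 != set0 by apply: contraNneq n0 => <-.
have sub1 s x : s \in K -> x \in s -> [set x] \in K.
  by move=> Ks xs; apply: down Ks _ _; rewrite ?sub1set //; apply/set0Pn; exists x; rewrite set11.
have Kv0 := sub1 _ _ Ks0 sv0.
case: (@arg_minP _ _ _ v0 (fun v => [set v] \in K) (fun v => f [set v]) Kv0) => v Kv vmin.
exists v; rewrite inE Kv /=; apply/andP; split; apply/eqP/setP=> t; rewrite !inE.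
  apply/negP=> /and3P[Kt /andP[vt]]; rewrite cards1 => /eqP ct fv.
  have /subsetPn[w tw] : ~~ (t \subset [set v]).
    by apply/negP=> /subset_leq_card; rewrite ct cards1.
  rewrite inE => wv; case/negP: wv; apply/eqP/set1_inj.
  apply: (card_le1_eq (dm t Kt).2); rewrite inE /is_facet ?sub1set ?cards1 ct eqxx ?tw.
    by rewrite (sub1 t) //= (le_trans fv) // vmin // (sub1 t).
  by rewrite Kv -sub1set vt.
apply/negP=> /and3P[Kt /andP[_ /eqP]]; rewrite cards1 => -[/esym/eqP].
by rewrite cards_eq0 => /eqP e; rewrite -e Kt in n0.
Qed.

(* In the top dimension, the free face is the one with the largest value. *)
Lemma collapsible_critical1 K f : simplicial_complex K -> discrete_morse K f ->
  #|critical_faces K f| = 1 -> collapsible K.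
Proof.
have [n] := ubnP #|K|; elim: n K => // n IH K leK cK dm c1.
have [n0 down] := cK.
have K0 : K != set0.
  apply/eqP=> K0; move: c1; rewrite (_ : critical_faces K f = set0) ?cards0 //.
  by apply/setP=> s; rewrite !inE K0 !inE.
have [v cv] := min_vertex_critical cK dm K0.
have critE s : s \in critical_faces K f -> s = [set v].
  by move=> cs; apply: card_le1_eq cs cv; rewrite c1.
have /set0Pn[s0 Ks0] := K0.
case: (@arg_maxnP _ s0 (mem K) (fun s => #|s|) Ks0) => tm Ktm tmax'.
have tmax q : q \in K -> #|q| <= #|tm| by apply: tmax'.
clear tmax'.
(* When all faces are vertices, each of them is critical, so there is only one. *)
have [small|big] := leqP #|tm| 1.
  exists v; suff -> : K = [set [set v]] by rewrite connect0.
  apply/setP=> s; rewrite inE; apply/idP/eqP => [Ks|->]; last by move: cv; rewrite inE => /andP[].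
  apply: critE; rewrite inE Ks /=.
  have card1 r : r \in K -> #|r| = 1.
    move=> Kr; apply/eqP; rewrite eqn_leq (leq_trans (tmax r Kr)) // card_gt0.
    by apply: contraNneq n0 => <-.
  apply/andP; split; apply/eqP/setP=> r; rewrite !inE; apply/negP => /and3P[Kr /andP[_]].
    by rewrite !card1.
  by rewrite !card1.
have lower_top t : t \in K -> #|t| = #|tm| -> lower_exceptions K f t != set0.
  move=> Kt ct; apply/negP=> lt0; have /critE e : t \in critical_faces K f.
    rewrite inE Kt lt0 andbT; apply/eqP/setP=> r; rewrite !inE; apply/negP.
    by case/and3P=> Kr /andP[_ /eqP cr] _; have := tmax r Kr; rewrite cr ct ltnn.
  by move: ct big; rewrite e cards1 => <-.
pose P s := [&& s \in K, #|s|.+1 == #|tm| & upper_exceptions K f s != set0].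
have PI r t : t \in K -> #|t| = #|tm| -> r \in lower_exceptions K f t -> P r.
  move=> Kt ct; rewrite inE => /and3P[Kr /andP[rt /eqP cr] le].
  by rewrite /P Kr -cr ct eqxx; apply/set0Pn; exists t; rewrite inE Kt /is_facet rt cr eqxx.
have /set0Pn[r0 /(PI _ _ Ktm erefl) Pr0] := lower_top _ Ktm erefl.
case: (@arg_maxP _ _ _ r0 P f Pr0) => s /and3P[Ks /eqP cs us] smax.
have /set0Pn[t] := us; rewrite inE => /and3P[Kt /andP[st /eqP ct] fts].
have ut q : q \in K -> s \proper q -> q = t.
  move=> Kq sq; have cq : #|q| = #|tm|.
    by apply/eqP; rewrite eqn_leq tmax // -cs proper_card.
  have /set0Pn[r lr] := lower_top _ Kq cq.
  (* Either [q] is an upper exception of [s], as [t] is, or a lower exception of [q] has a larger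
     value than [s], against the choice of [s]. *)
  have [fle|flt] := leP (f q) (f s).
    apply: (card_le1_eq (dm s Ks).1);
      rewrite inE ?Kq ?Kt /is_facet ?(proper_sub sq) ?st ?fle ?fts andbT.
      by rewrite cq cs eqxx.
    by rewrite ct eqxx.
  have := smax _ (PI _ _ Kq cq lr); move: lr; rewrite inE => /and3P[_ _ fqr].
  by move=> /(le_trans fqr)/(lt_le_trans flt); rewrite ltxx.
have pst : s \proper t by rewrite properEcard st ct ltnSn.
have free : [set q in K | s \proper q] = [set t].
  apply/setP=> q; rewrite !inE; apply/andP/eqP => [[]|->]; [exact: ut|by []].
pose L := K :\: [set s; t].
have KL : elementary_collapse K L.
  by apply/elementary_collapseP; exists s, t; split.
have LK : L \subset K by apply: subsetDl.
have tus : t \in upper_exceptions K f s by rewrite inE Kt /is_facet st ct eqxx.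
have slt : s \in lower_exceptions K f t by rewrite inE Ks /is_facet st ct eqxx.
(* Neither [s] nor [t] is an exception of any other face, so removing them changes no other
   exceptions. *)
have upE r : r \in L -> upper_exceptions L f r = upper_exceptions K f r.
  rewrite inE => /andP[nr Kr]; apply/setP=> q; rewrite !inE.
  case: (boolP (q \in K)) => Kq; last by rewrite andbF.
  rewrite andbT /=; have [|//] := boolP ((q == s) || (q == t)).
  case/orP=> /eqP->/=; apply/esym/negP => /andP[rq le].
    have /setP/(_ r) := exceptions_exclusive cK dm Ks us.
    by rewrite !inE Kr rq le.
  have e : r = s by apply: (card_le1_eq (dm t Kt).2) slt; rewrite inE Kr rq.
  by rewrite e !inE eqxx in nr.
have loE r : r \in L -> lower_exceptions L f r = lower_exceptions K f r.
  rewrite inE => /andP[nr Kr]; apply/setP=> q; rewrite !inE.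
  case: (boolP (q \in K)) => Kq; last by rewrite andbF.
  rewrite andbT /=; have [|//] := boolP ((q == s) || (q == t)).
  case/orP=> /eqP->/=; apply/esym/negP => /andP[qr le].
    have e : r = t by apply: ut Kr (facet_proper qr).
    by rewrite e !inE eqxx orbT in nr.
  by have := tmax r Kr; case/andP: qr => _ /eqP ->; rewrite ct cs ltnn.
have dmL : discrete_morse L f.
  by move=> r Lr; rewrite upE // loE //; apply: dm; apply: (subsetP LK).
have critL : critical_faces L f = critical_faces K f.
  apply/setP=> r; rewrite [LHS]inE [RHS]inE; have [Lr|nL] := boolP (r \in L).
    by rewrite upE // loE // (subsetP LK).
  have [Kr|//] := boolP (r \in K); move: nL; rewrite inE Kr andbT negbK !inE /=.
  case/orP=> /eqP->; first by rewrite (negbTE us).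
  by rewrite [lower_exceptions _ _ _ == _](_ : _ = false) ?andbF //; apply/negbTE/set0Pn; exists s.
have [|//|w Lw] := IH L _ (elementary_collapse_complex cK KL) dmL; last 1 first.
- by exists w; apply: connect_trans (connect1 KL) Lw.
- have LK' : L \proper K by rewrite properE LK; apply/subsetPn; exists s; rewrite // !inE eqxx.
  exact: leq_trans (proper_card LK') leK.
- by rewrite critL.
Qed.

Lemma critical_card_ge3 K f g : simplicial_complex K -> ~ collapsible K ->
  discrete_morse K f -> #|critical_faces K f| = 3 ->
  discrete_morse K g -> 3 <= #|critical_faces K g|.
Proof.
move=> cK nK df cf dg; have := critical_card_parity cK dg.
rewrite -(critical_card_parity cK df) cf.
case e : #|critical_faces K g| => [|[|[|n]]] //= _.
by case: nK; apply: (@collapsible_critical1 K g).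
Qed.

End LowerBound.

(** * Wedges *)

Definition subface (s r : seq nat) : bool := all (mem r) s.
Definition face_ins (n x : nat) (s : seq nat) : seq nat :=
  [seq i <- iota 0 n.+2 | (i == x) || (i \in s)].
Definition face_del (n x : nat) (s : seq nat) : seq nat :=
  [seq i <- iota 0 n.+2 | (i != x) && (i \in s)].
(** Says that [s] is strictly increasing with entries at most [n.+1], so that each face has a unique
    list. *)
Definition wf_face (n : nat) (s : seq nat) : bool :=
  s == [seq i <- iota 0 n.+2 | i \in s].

(* An entry [(s, Some x)] of a certificate removes the star of [s], whose link must be
   a cone with apex [x]; an entry [(s, None)] removes [s] as a critical face. *)
Definition remove_star (s : seq nat) (B : seq (seq nat)) :=
  [seq r <- B | ~~ subface s r].

Definition star_ok n (B : seq (seq nat)) (s : seq nat) (x : nat) : bool :=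
  [&& s != [::], x < n.+2, x \notin s &
   all (fun r => subface s r ==> (face_ins n x r \in B) && (face_del n x r \in B)) B].

Definition crit_ok n (B : seq (seq nat)) (s : seq nat) : bool :=
  [&& s != [::], wf_face n s, s \in B & all (fun r => subface s r ==> (r == s)) B].

Fixpoint reduces n (B : seq (seq nat)) (c : seq (seq nat * option nat))
    (B' : seq (seq nat)) : bool :=
  if c is (s, o) :: c' then
    (if o is Some x then star_ok n B s x else crit_ok n B s)
    && reduces n (remove_star s B) c' B'
  else B == B'.

Section Wedge.

Variables n k : nat.

(** The left summand holds the vertices 0, ..., [n] of the base, the right one the [k.+1] vertices
    that replace [n.+1]; the dimension grows by [k]. *)
Definition wvertex : finType := ('I_n.+1 + 'I_k.+1)%type.

Implicit Types (w : {set wvertex}) (s r : seq nat) (B : seq (seq nat)).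

Definition base (i : nat) : wvertex := inl (inord i).
Definition W0 : wvertex := inr ord0.
Definition simplexW : {set wvertex} := [set x : wvertex | if x is inr _ then true else false].

(* The index [n.+1] stands for the vertex replaced by [simplexW]. *)
Definition has_code w i := if i <= n then base i \in w else simplexW \subset w.
Definition code w : seq nat := [seq i <- iota 0 n.+2 | has_code w i].

Definition wedge B : {set {set wvertex}} :=
  [set w | (w != set0) && (code w \in [::] :: B)].

(* When [s] does not contain [n.+1], the faces with code [s] form the product of [s]
   with all proper subsets of [simplexW]; removing [wtop s], they cancel in pairs. *)
Definition wtop s : {set wvertex} :=
  [set x : wvertex | match x : 'I_n.+1 + 'I_k.+1 with
           | inl a => (a : nat) \in s
           | inr j => (n.+1 \in s) || (j != ord0)
           end].

(** For the replaced vertex a single vertex [W0] suffices: removing it removes [n.+1] from the code,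
    and adding it either completes [simplexW] or leaves the code alone. *)
Definition toggled (x : nat) : wvertex := if x <= n then base x else W0.

Lemma mem_code i w : (i \in code w) = (i < n.+2) && has_code w i.
Proof. by rewrite mem_filter mem_iota /= add0n andbC. Qed.

Lemma eq_code w r : (forall i, i < n.+2 -> has_code w i = (i \in r)) ->
  code w = [seq i <- iota 0 n.+2 | i \in r].
Proof. by move=> h; apply: eq_in_filter => i; rewrite mem_iota; apply: h. Qed.

Lemma code_wf w : wf_face n (code w).
Proof. by apply/eqP/eq_code => i lti; rewrite mem_code lti. Qed.

Lemma base_eq i (a : 'I_n.+1) : i <= n -> (base i == inl a) = (i == a).
Proof.
move=> le; apply/eqP/eqP => [[<-]|->]; first by rewrite inordK.
by rewrite /base inord_val.
Qed.

Lemma subfaceP s r : reflect {subset s <= r} (subface s r).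
Proof. exact: allP. Qed.

Lemma simplexW_subset w : (simplexW \subset w) = [forall j : 'I_k.+1, inr j \in w].
Proof.
apply/subsetP/forallP => [h j|h [a|j]]; rewrite ?inE //; by apply: h; rewrite inE.
Qed.

Lemma mem_code_last w : (n.+1 \in code w) = (simplexW \subset w).
Proof. by rewrite mem_code /has_code ltnSn ltnn. Qed.

Lemma inl_mem_code (a : 'I_n.+1) w : (inl a \in w) = ((a : nat) \in code w).
Proof.
have lea : a <= n by rewrite -ltnS.
by rewrite mem_code /has_code lea ltnS leqW // /base inord_val.
Qed.

Lemma code_subset w w' : w \subset w' -> subface (code w) (code w').
Proof.
move=> /subsetP ww'; apply/subfaceP=> i; rewrite !mem_code => /andP[-> /=].
rewrite /has_code; case: ifP => _; first exact: ww'.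
by move/subset_trans; apply; apply/subsetP.
Qed.

Lemma code_set0 : code set0 = [::].
Proof.
apply/eqP; rewrite -[_ == _]negbK -has_filter; apply/hasPn=> i _.
rewrite /has_code; case: ifP => _; first by rewrite inE.
by rewrite simplexW_subset; apply/forallPn; exists ord0; rewrite inE.
Qed.

Lemma code_neq0 w : code w != [::] -> w != set0.
Proof. by apply: contraNneq => ->; rewrite code_set0. Qed.

Lemma subface_nil s r : s != [::] -> subface s r -> r != [::].
Proof. by case: s => // x s _ /andP[xr _]; apply: contraTneq xr => ->. Qed.

Lemma code_del x w : x < n.+2 -> code (w :\ toggled x) = face_del n x (code w).
Proof.
move=> ltx; apply: eq_in_filter => i; rewrite mem_iota add0n => /andP[_ lti].
rewrite mem_code lti /= /has_code /toggled; case: (leqP x n) => lex; case: (leqP i n) => lei.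
- by rewrite !inE {1}/base eq_sym base_eq // inordK // eq_sym.
- have -> : i != x by lia.
  by rewrite !simplexW_subset; apply: eq_forallb => j; rewrite !inE.
- by rewrite !inE; have -> : i != x by lia.
- have -> : i = x by lia.
  rewrite eqxx /= simplexW_subset; apply/negbTE/forallPn; exists ord0.
  by rewrite !inE eqxx.
Qed.

Lemma code_add x w : x < n.+2 ->
  code (toggled x |: w) = face_ins n x (code w) \/ code (toggled x |: w) = code w.
Proof.
move=> ltx; rewrite /toggled; case: (leqP x n) => lex.
  left; apply: eq_in_filter => i; rewrite mem_iota add0n => /andP[_ lti].
  rewrite mem_code lti /= /has_code; case: (leqP i n) => lei.
    by rewrite !inE {1}/base eq_sym base_eq // inordK // eq_sym.
  have /negbTE-> : i != x by lia.
  by rewrite !simplexW_subset; apply: eq_forallb => j; rewrite !inE.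
have -> : x = n.+1 by lia.
case: (boolP (simplexW \subset W0 |: w)) => h; [left|right].
  apply: eq_in_filter => i; rewrite mem_iota add0n => /andP[_ lti].
  rewrite mem_code lti /= /has_code; case: (leqP i n) => lei; last first.
    by rewrite h; have -> : i == n.+1 by lia.
  by rewrite !inE; have /negbTE-> : i != n.+1 by lia.
apply: eq_in_filter => i; rewrite mem_iota add0n => /andP[_ lti].
rewrite /has_code; case: (leqP i n) => lei; first by rewrite !inE.
rewrite (negbTE h); apply/esym/negbTE; apply: contra h => /subset_trans; apply.
exact: subsetUr.
Qed.

(** The faces whose code contains [s] are closed under cofaces and, the link of [s] being a cone,
    under adding and removing [toggled x]; so [toggle_collapse] removes them. *)
Lemma star_collapse B s x : star_ok n B s x ->
  connect (@elementary_collapse wvertex) (wedge B) (wedge (remove_star s B)).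
Proof.
case/and4P=> s0 ltx xs /allP cone.
pose M := [set w in wedge B | subface s (code w)].
have -> : wedge (remove_star s B) = wedge B :\: M.
  apply/setP=> w; rewrite !inE mem_filter.
  have [|nsw] := boolP (subface s (code w)); rewrite /= ?andbT.
    move=> h; rewrite (negbTE (subface_nil s0 h)) /= andbF.
    by case: (w == set0) (_ \in B) => [] [].
  by rewrite andbF.
apply: (@toggle_collapse _ _ _ (toggled x)).
- by apply/subsetP=> w; rewrite inE => /andP[].
- move=> w t; rewrite inE => /andP[_ sw] Kt wt; rewrite inE Kt /=.
  by apply/subfaceP=> i /(subfaceP _ _ sw); apply/subfaceP/code_subset.
move=> w; rewrite inE => /andP[]; rewrite inE => /andP[w0].
move=> wB sw; have cw0 := subface_nil s0 sw.
have {}wB : code w \in B by move: wB; rewrite inE (negbTE cw0).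
have /implyP/(_ sw)/andP[insB delB] := cone _ wB.
split.
  rewrite inE; apply/andP; split.
    rewrite inE; apply/andP; split.
      by apply/set0Pn; exists (toggled x); rewrite !inE eqxx.
    by rewrite inE; case: (code_add w ltx) => ->; rewrite ?wB ?insB orbT.
  by apply/subfaceP=> i /(subfaceP _ _ sw); apply/subfaceP/code_subset/subsetUr.
have sd : subface s (code (w :\ toggled x)).
  rewrite code_del //; apply/subfaceP=> i si; have iw := subfaceP _ _ sw i si.
  rewrite mem_filter iw mem_iota add0n; move: iw; rewrite mem_code => /andP[-> _].
  by rewrite !andbT; apply: contraNneq xs => <-.
rewrite inE sd andbT inE (code_neq0 (subface_nil s0 sd)) /=.
by rewrite code_del // inE delB orbT.
Qed.

Lemma code_wtop s : wf_face n s -> code (wtop s) = s.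
Proof.
move=> /eqP wf; rewrite [RHS]wf; apply: eq_code => i lti.
rewrite /has_code; case: (leqP i n) => lei; first by rewrite inE /= inordK.
have -> : i = n.+1 by lia.
rewrite simplexW_subset; apply/forallP/idP => [/(_ ord0)|h j]; rewrite inE ?eqxx ?orbF //.
by rewrite h.
Qed.

Lemma wtop_max s w : code w = s -> wtop s \subset w -> w = wtop s.
Proof.
move=> cw sw; apply/eqP; rewrite eqEsubset sw andbT; apply/subsetP=> -[a|j].
  by rewrite inl_mem_code cw inE.
rewrite inE; case: (boolP (n.+1 \in s)) => //= ns; apply: contraTN => /eqP->.
apply: contraNN ns => w0; rewrite -cw mem_code_last.
rewrite simplexW_subset; apply/forallP=> i; have [-> //|ni] := eqVneq i ord0.
by apply: (subsetP sw); rewrite inE ni orbT.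
Qed.

Lemma wtop_unique s w : n.+1 \in s -> code w = s -> w = wtop s.
Proof.
move=> ns cw; apply: wtop_max => //; apply/subsetP=> -[a|j].
  by rewrite inE -cw inl_mem_code.
by move: ns; rewrite -cw mem_code_last => /subsetP h _; apply: h; rewrite inE.
Qed.

(** After [wtop s] is made critical, the other faces with code [s] are matched by toggling [W0] and
    collapse away; there are none when [s] contains [n.+1]. *)
Lemma crit_critical_set (R : realDomainType) B s C :
  simplicial_complex (wedge B) -> crit_ok n B s ->
  (simplicial_complex (wedge (remove_star s B)) ->
   has_critical_set R (wedge (remove_star s B)) C) ->
  has_critical_set R (wedge B) (wtop s |: C).
Proof.
move=> cK /and4P[s0 wfs sB /allP smax].
have max w : w \in wedge B -> subface s (code w) -> code w = s.
  rewrite inE => /andP[_]; rewrite inE => /orP[/eqP-> /(subface_nil s0)//|].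
  by move=> /smax /implyP h /h /eqP.
have tK : wtop s \in wedge B.
  by rewrite inE inE code_wtop // sB orbT andbT; apply: code_neq0; rewrite code_wtop.
have tmax (r : {set wvertex}) : r \in wedge B -> wtop s \subset r -> r = wtop s.
  move=> Kr tr; apply: wtop_max => //; apply: max => //.
  by rewrite -{1}(code_wtop wfs); apply: code_subset.
move=> hC; apply: (add_critical_face tK tmax).
have cK' : simplicial_complex (wedge B :\ wtop s).
  by apply: upclosed_complex => // r r' /set1P-> Kr' /(tmax _ Kr') ->; rewrite set11.
suff cl : connect (@elementary_collapse wvertex) (wedge B :\ wtop s) (wedge (remove_star s B)).
  by apply: (connect_critical_set cK' cl); apply: hC; apply: connect_complex cl.
pose M := [set w in wedge B | (code w == s) && (w != wtop s)].
have -> : wedge (remove_star s B) = (wedge B :\ wtop s) :\: M.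
  apply/setP=> w; have [ew|nw] := boolP (subface s (code w)).
    rewrite [in LHS]inE inE mem_filter ew /= orbF (negbTE (subface_nil s0 ew)) andbF.
    rewrite in_setD in_setD1 inE; case: (boolP (w \in wedge B)) => Kw; rewrite ?andbF //=.
    by rewrite (max _ Kw ew) eqxx /=; case: (w == wtop s).
  have ne : code w != s by apply: contraNneq nw => ->; apply/subfaceP.
  have nt : w != wtop s by apply: contraNneq nw => ->; rewrite code_wtop //; apply/subfaceP.
  by rewrite in_setD in_setD1 nt !inE (negbTE ne) /= andbF /= mem_filter nw.
have inM w : w \in M -> [/\ w != set0, code w = s & w != wtop s].
  by rewrite inE => /and3P[]; rewrite inE => /andP[w0 _] /eqP.
have nsM w : w \in M -> n.+1 \notin s.
  move=> /inM[_ cw wt]; apply: contraNN wt => ns; exact/eqP/wtop_unique.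
apply: (@toggle_collapse _ _ _ W0).
- apply/subsetP=> w Mw; have [_ _ wt] := inM _ Mw.
  by move: Mw; rewrite inE in_setD1 wt => /andP[].
- move=> w r /inM[_ cw wt]; rewrite in_setD1 => /andP[rt Kr] wr.
  rewrite inE Kr rt andbT /=; apply/eqP/max => //; rewrite -cw; exact: code_subset.
- move=> w Mw; have [w0 cw wt] := inM _ Mw; have ns := nsM _ Mw.
  have nW : ~~ (simplexW \subset w) by rewrite -mem_code_last cw.
  have inM' w' : code w' = s -> w' != wtop s -> w' \in M.
    move=> c' t'; rewrite inE c' eqxx t' inE inE c' sB orbT /= !andbT.
    by apply: code_neq0; rewrite c'.
  have [W0w|W0w] := boolP (W0 \in w); last first.
    have wd : w :\ W0 = w by apply/setDidPl; rewrite disjoint_sym disjoints1.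
    split; last by rewrite wd.
    (* Otherwise [w] would contain all of [simplexW] except [W0], and would be [wtop s]. *)
    have h : ~~ (simplexW \subset W0 |: w).
      apply: contraNN wt => h; apply/eqP/wtop_max => //; apply/subsetP=> -[a|j].
        by rewrite inE inl_mem_code cw.
      rewrite inE (negbTE ns) /= => j0; have := subsetP h (inr j).
      by rewrite !inE => /(_ isT)/orP[/eqP[e]|//]; rewrite e eqxx in j0.
    apply: inM'.
      rewrite -cw; apply: eq_in_filter => i _; rewrite /has_code; case: ifP => _.
        by rewrite !inE.
      by rewrite (negbTE h) (negbTE nW).
    apply: contraNneq W0w => e; have := setU11 W0 w; rewrite e inE /= (negbTE ns).
    by [].
  split; first by rewrite (setUidPr _) // sub1set.
  apply: inM'.
    have -> : W0 = toggled n.+1 by rewrite /toggled ltnn.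
    rewrite code_del // cw /face_del [RHS](eqP wfs); apply: eq_filter => i.
    by case: eqP => [->|//]; rewrite (negbTE ns).
  apply: contraNneq nW => e; rewrite simplexW_subset; apply/forallP=> j.
  have [-> //|j0] := eqVneq j ord0.
  have : inr j \in wtop s by rewrite inE /= j0 orbT.
  by rewrite -e !inE => /andP[].
Qed.

Lemma mem_wedge_point w :
  (w \in wedge [:: [:: n.+1]]) = (w != set0) && (w \subset simplexW).
Proof.
rewrite inE; congr (_ && _); apply/idP/idP => [cw|/subsetP h].
  apply/subsetP=> -[a|j]; last by rewrite inE.
  rewrite inl_mem_code => aw; move: cw; rewrite !inE => /orP[]/eqP e; rewrite e ?inE in aw => //.
  by have := ltn_ord a; rewrite (eqP aw) ltnn.
have nb i : i <= n -> has_code w i = false.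
  by move=> lei; rewrite /has_code lei; apply/negP => /h; rewrite inE.
have e : code w = [seq i <- iota 0 n.+2 | (i == n.+1) && (simplexW \subset w)].
  apply: eq_in_filter => i; rewrite mem_iota add0n => /andP[_ lti].
  case: (leqP i n) => lei; first by rewrite nb //; have /negbTE-> : i != n.+1 by lia.
  by rewrite /has_code leqNgt lei /=; have -> : i == n.+1 by lia.
rewrite e; case: (simplexW \subset w).
  rewrite (eq_filter (a2 := pred1 n.+1)) => [|i]; last by rewrite /= andbT.
  rewrite filter_pred1_uniq ?iota_uniq //; last by rewrite mem_iota add0n ltnSn.
  by rewrite !inE eqxx orbT.
rewrite (eq_filter (a2 := pred0)) => [|i]; last by rewrite /= andbF.
by rewrite filter_pred0.
Qed.

(** The wedge of the replaced vertex alone is the full simplex on [simplexW], a cone with apex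
    [W0]. *)
Lemma wedge_point_collapse :
  connect (@elementary_collapse wvertex) (wedge [:: [:: n.+1]]) [set [set W0]].
Proof.
pose M := wedge [:: [:: n.+1]] :\ [set W0].
have -> : [set [set W0]] = wedge [:: [:: n.+1]] :\: M.
  apply/setP=> w; rewrite in_setD in_setD1 in_set1; case: eqP => [->|_] /=.
    by rewrite mem_wedge_point sub1set inE andbT; apply/esym/set0Pn; exists W0; rewrite inE.
  by case: (_ \in _).
apply: (@toggle_collapse _ _ _ W0).
- exact: subsetDl.
- move=> w r; rewrite !in_setD1 !mem_wedge_point.
  case/and3P=> w1 w0 _ /andP[r0 rW] wr; rewrite r0 rW !andbT.
  apply: contraNneq w1 => e; move: wr; rewrite e subset1.
  by rewrite (negbTE w0) orbF.
- move=> w; rewrite !in_setD1 !mem_wedge_point => /andP[w1 /andP[w0 wW]]; split.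
    have W0W : W0 |: w \subset simplexW by rewrite subUset sub1set inE.
    rewrite W0W andbT; apply/andP; split.
      apply: contraNneq w1 => e; have : w \subset [set W0] by rewrite -e subsetUr.
      by rewrite subset1 (negbTE w0) orbF.
    by apply/set0Pn; exists W0; rewrite !inE eqxx.
  rewrite (subset_trans (subsetDl _ _) wW) andbT; apply/andP; split.
    by apply/eqP=> /setP/(_ W0); rewrite !inE eqxx.
  by rewrite setD_eq0 subset1 (negbTE w0) orbF.
Qed.

Definition is_collapse (c : seq (seq nat * option nat)) := all (fun a => a.2 != None) c.

Lemma reduces_collapse B c B' : is_collapse c -> reduces n B c B' ->
  connect (@elementary_collapse wvertex) (wedge B) (wedge B').
Proof.
elim: c B => [|[s [x|//]] c IH] B /= => [_ /eqP-> //|ac /andP[h r]].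
exact: connect_trans (star_collapse h) (IH _ ac r).
Qed.

Definition critical_of (c : seq (seq nat * option nat)) : {set {set wvertex}} :=
  foldr (fun a C => if a.2 is None then wtop a.1 |: C else C) [set [set W0]] c.

Lemma reduces_critical (R : realDomainType) B c :
  simplicial_complex (wedge B) -> reduces n B c [:: [:: n.+1]] ->
  has_critical_set R (wedge B) (critical_of c).
Proof.
elim: c B => [|[s [x|]] c IH] B cK /=.
- move/eqP=> e; rewrite e in cK *.
  apply: (connect_critical_set cK wedge_point_collapse).
  rewrite -[[set [set W0]]]setU0; apply: add_critical_face; rewrite ?setU0 ?set11 //.
    by move=> r /set1P.
  by rewrite setDv; apply: has_critical_set_empty.
- case/andP=> h r; have cl := star_collapse h.
  by apply: (connect_critical_set cK cl); apply: IH r; apply: connect_complex cl.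
- by case/andP=> h r; apply: crit_critical_set h _ => // cK'; apply: IH.
Qed.

(** The extra term on the left is due to [n.+1], which stands in the code for all of [simplexW] at
    once. *)
Lemma card_code w :
  #|w| + (simplexW \subset w) = size (code w) + #|[set j : 'I_k.+1 | inr j \in w]|.
Proof.
have -> : size (code w) = #|[set a : 'I_n.+1 | inl a \in w]| + (simplexW \subset w).
  rewrite /code -(addn1 n.+1) iotaD filter_cat size_cat add0n.
  congr (_ + _); last by rewrite /= /has_code ltnn; case: ifP.
  rewrite size_filter -val_enum_ord count_map -sum1_count big_enum_cond -sum1_card.
  by apply: eq_bigl => a /=; rewrite inE /has_code -ltnS ltn_ord /base inord_val.
rewrite addnAC; congr (_ + _).
rewrite -!sum1_card big_sumType /=.
by congr (_ + _); apply: eq_bigl => a; rewrite inE.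
Qed.

End Wedge.

(** * Faces and cofaces in wedges *)

Definition closed_list n (B : seq (seq nat)) : bool :=
  all (wf_face n) B && all (fun r => all (fun i => face_del n i r \in [::] :: B) r) B.

(** Each coface of codimension one is represented by its additional vertex. *)
Definition cofaces n (C : seq (seq nat)) (s : seq nat) : seq nat :=
  [seq x <- iota 0 n.+2 | (x \notin s) && (face_ins n x s \in C)].

Section WedgeCofaces.

Variables n k : nat.
Implicit Types (w : {set wvertex n k}) (s r : seq nat) (B C : seq (seq nat)).

Lemma wf_face_filter (a : pred nat) : wf_face n [seq i <- iota 0 n.+2 | a i].
Proof.
apply/eqP/eq_in_filter => i; rewrite mem_filter mem_iota => ->.
by rewrite andbT.
Qed.

(** The vertices in [l] are deleted one at a time, since [closed_list] speaks of single
    deletions. *)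
Lemma closed_filter B r (l : seq nat) : closed_list n B -> r \in B ->
  [seq i <- iota 0 n.+2 | (i \notin l) && (i \in r)] \in [::] :: B.
Proof.
move=> /andP[/allP wfB /allP clB] rB; elim: l => [|x l IH].
  have <- : r = [seq i <- iota 0 n.+2 | (i \notin [::]) && (i \in r)] := eqP (wfB r rB).
  by rewrite inE rB orbT.
set r' := [seq i <- _ | _] in IH.
have e : [seq i <- iota 0 n.+2 | (i \notin x :: l) && (i \in r)] = face_del n x r'.
  apply: eq_in_filter => i ii; rewrite mem_filter ii inE negb_or andbT -andbA.
  by case: (i != x).
rewrite e; have [xr|xr] := boolP (x \in r').
  move: IH; rewrite inE => /orP[/eqP r0|r'B]; first by rewrite r0 in xr.
  exact: (allP (clB _ r'B)).
suff -> : face_del n x r' = r' by [].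
rewrite [RHS](eqP (wf_face_filter _)); apply: eq_in_filter => i _.
by case: eqP => // ->; rewrite (negbTE xr).
Qed.

Lemma closed_subface B s r : closed_list n B -> wf_face n s ->
  r \in [::] :: B -> subface s r -> s \in [::] :: B.
Proof.
move=> cB wfs; rewrite inE => /orP[/eqP->|rB sr]; first by case: s wfs.
have -> : s = [seq i <- iota 0 n.+2 | (i \notin [seq i <- r | i \notin s]) && (i \in r)].
  rewrite [LHS](eqP wfs); apply: eq_in_filter => i _; rewrite mem_filter.
  have [ii|ni] := boolP (i \in s); first by rewrite (subfaceP _ _ sr).
  by case: (i \in r).
exact: closed_filter.
Qed.

Lemma wedge_down B (s q : {set wvertex n k}) : closed_list n B ->
  q \in wedge n k B -> s \subset q -> s != set0 -> s \in wedge n k B.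
Proof.
rewrite !inE -!in_cons => cB /andP[_ qB] sq -> /=.
by apply: closed_subface qB (code_subset sq) => //; apply: code_wf.
Qed.

Lemma wedge_complex B : closed_list n B -> simplicial_complex (wedge n k B).
Proof.
by move=> cB; split=> [|s q qB sq s0]; [rewrite !inE eqxx|apply: wedge_down sq s0].
Qed.

Lemma wedge_subset B C : {subset C <= B} -> wedge n k C \subset wedge n k B.
Proof.
move=> CB; apply/subsetP=> w; rewrite !inE => /andP[-> /orP[->//|/CB->]].
by rewrite orbT.
Qed.

Lemma card_inr w :
  #|[set j : 'I_k.+1 | inr j \in w]| <= k + (simplexW n k \subset w) /\
  (simplexW n k \subset w -> #|[set j : 'I_k.+1 | inr j \in w]| = k.+1).
Proof.
rewrite simplexW_subset; case: forallP => [h|nh]; split=> //.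
- by rewrite addn1; have := max_card [set j : 'I_k.+1 | inr j \in w]; rewrite card_ord.
- move=> _; rewrite (_ : [set j | _] = setT) ?cardsT ?card_ord //.
  by apply/setP=> j; rewrite !inE h.
- rewrite addn0 -ltnS -[X in _ < X](card_ord k.+1) -cardsT proper_card // properT.
  by apply/eqP=> e; apply: nh => j; have := in_setT j; rewrite -e inE.
Qed.

Lemma card_le_code w : #|w| <= size (code w) + k.
Proof. by have := card_code w; have [] := card_inr w; lia. Qed.

Lemma card_wtop s : wf_face n s -> #|wtop n k s| = size s + k.
Proof.
move=> wfs; have := card_code (wtop n k s); rewrite code_wtop // -mem_code_last code_wtop //.
have -> : [set j : 'I_k.+1 | inr j \in wtop n k s] =
          if n.+1 \in s then setT else [set~ ord0].
  by apply/setP=> j; rewrite inE inE /=; case: (n.+1 \in s); rewrite !inE.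
case: (n.+1 \in s); first by rewrite cardsT card_ord; lia.
by rewrite cardsC1 card_ord; lia.
Qed.

Lemma subset_wtop w s : n.+1 \in s -> subface (code w) s -> w \subset wtop n k s.
Proof.
move=> ns /subfaceP cs; apply/subsetP=> -[a|j]; rewrite inE /= ?ns //.
by rewrite inl_mem_code => /cs.
Qed.

Lemma wtop_subset s r : n.+1 \in r -> wf_face n s -> subface s r ->
  wtop n k s \subset wtop n k r.
Proof. by move=> nr wfs sr; apply: subset_wtop => //; rewrite code_wtop. Qed.

Lemma code_add_inr (j : 'I_k.+1) w : code (inr j |: w) =
  if simplexW n k \subset inr j |: w then face_ins n n.+1 (code w) else code w.
Proof.
case: ifP => h; apply: eq_in_filter => i; rewrite mem_iota add0n => /andP[_ lti].
  rewrite /has_code; case: (leqP i n) => lei.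
    by rewrite mem_code lti /has_code lei !inE; have /negbTE-> : i != n.+1 by lia.
  by rewrite h; have -> : i == n.+1 by lia.
rewrite /has_code; case: (leqP i n) => lei; first by rewrite !inE.
rewrite h; apply/esym/negbTE; apply: contraFN h => /subset_trans; apply.
exact: subsetUr.
Qed.

(* In codimension one, a face either corresponds to a face of the base, and then
   its cofaces correspond to those of this face, or it misses two vertices of the
   simplex replacing the apex, and can be completed by either of them. *)
Lemma wedge_cofaces m C w (P : Prop) :
  all (fun s => size s <= m.+1) C -> #|w| = m + k -> code w \in C ->
  (size (code w) = m -> 0 < size (cofaces n C (code w)) /\
                        (1 < size (cofaces n C (code w)) \/ P)) ->
  exists q q', [/\ q \in wedge n k C, q' \in wedge n k C,
    #|q| = (m + k).+1 /\ #|q'| = (m + k).+1,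
    w \subset q /\ w \subset q' & q != q' \/ P].
Proof.
move=> /allP szC cw wC hb.
have sz : size (code w) = m \/ size (code w) = m.+1.
  by have := card_le_code w; have := szC _ wC; lia.
have addj (j : 'I_k.+1) : inr j \notin w -> code (inr j |: w) \in C ->
    [/\ inr j |: w \in wedge n k C, #|inr j |: w| = (m + k).+1 & w \subset inr j |: w].
  move=> jw cC; split; last exact: subsetUr.
    by rewrite !inE cC orbT andbT; apply/set0Pn; exists (inr j); rewrite !inE eqxx.
  by rewrite cardsU1 jw cw.
have [inr1 inr2] := card_inr w; have cc := card_code w.
case: sz => sz.
  have lift x : x \in cofaces n C (code w) -> exists q, [/\ q \in wedge n k C,
      #|q| = (m + k).+1, w \subset q & code q = face_ins n x (code w)].
    rewrite mem_filter mem_iota add0n => /andP[/andP[xw xC] /= ltx].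
    case: (leqP x n) => lex.
      have bw : base n k x \notin w.
        by move: xw; rewrite mem_code ltx /has_code lex.
      have cq : code (base n k x |: w) = face_ins n x (code w).
        have := code_add w ltx; rewrite /toggled lex => -[//|e].
        have : x \in code (base n k x |: w) by rewrite mem_code ltx /has_code lex setU11.
        by rewrite e (negbTE xw).
      exists (base n k x |: w); split=> //; last exact: subsetUr.
        by rewrite !inE cq xC orbT andbT; apply/set0Pn; exists (base n k x); rewrite !inE eqxx.
      by rewrite cardsU1 bw cw.
    (* Adding the replaced vertex to the code means completing [simplexW]; by counting, [w] misses
       exactly one vertex [j] of it. *)
    have ex : x = n.+1 by lia.
    have nW : ~~ (simplexW n k \subset w) by rewrite -mem_code_last -ex.
    have cj : #|[set j : 'I_k.+1 | inr j \in w]| = k by move: cc; rewrite (negbTE nW) sz; lia.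
    pose J := [set j : 'I_k.+1 | inr j \notin w].
    have /eqP/cards1P[j eJ] : #|J| = 1.
      have := cardsC J; rewrite card_ord (_ : ~: J = [set j | inr j \in w]) ?cj; first lia.
      by apply/setP=> i; rewrite !inE negbK.
    have jw : inr j \notin w by have := set11 j; rewrite -eJ inE.
    have hW : simplexW n k \subset inr j |: w.
      rewrite simplexW_subset; apply/forallP=> i; rewrite !inE.
      have [//|iw] := boolP (inr i \in w); rewrite ?orbT // orbF.
      have : i \in J by rewrite inE.
      by rewrite eJ inE => /eqP->.
    have cq := code_add_inr j w; rewrite hW in cq.
    have [||a b c] := addj j; rewrite ?cq //; first by rewrite -[n.+1]ex.
    by exists (inr j |: w); rewrite cq ex.
  have [co1 co2] := hb sz.
  case: co2 => [co2|p].
    case eC : (cofaces n C (code w)) co2 => [|x [|x' l]] //= _.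
    have ux : uniq (cofaces n C (code w)) by rewrite filter_uniq ?iota_uniq.
    have xx' : x != x' by move: ux; rewrite eC /= inE negb_or => /andP[/andP[]].
    have [xC x'C] : x \in cofaces n C (code w) /\ x' \in cofaces n C (code w).
      by rewrite eC !inE !eqxx orbT.
    have [q [qC cq wq eq]] := lift x xC; have [q' [q'C cq' wq' eq']] := lift x' x'C.
    exists q, q'; split=> //; left; apply: contraNneq xx' => e.
    have : x \in face_ins n x' (code w).
      rewrite -eq' -e eq mem_filter eqxx /=.
      by move: xC; rewrite mem_filter => /andP[].
    rewrite mem_filter => /andP[/orP[//|xw] _].
    by move: xC; rewrite mem_filter xw.
  case eC : (cofaces n C (code w)) co1 => [|x l] //= _.
  have [q [qC cq wq _]] := lift x (eq_ind_r (fun l => is_true (x \in l)) (mem_head x l) eC).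
  by exists q, q; split=> //; right.
have nW : ~~ (simplexW n k \subset w).
  by apply/negP=> h; have := inr2 h; move: cc; rewrite h sz cw; lia.
pose J := [set j : 'I_k.+1 | inr j \notin w].
have /eqP/cards2P[j [j' [jj' eJ]]] : #|J| = 2.
  move: cc (cardsC J); rewrite card_ord (negbTE nW) sz cw (_ : ~: J = [set j | inr j \in w]).
    by set c := #|[set j | inr j \in w]|; lia.
  by apply/setP=> i; rewrite !inE negbK.
have nj i i' : i != i' -> i' \in J -> ~~ (simplexW n k \subset inr i |: w).
  rewrite inE => ii' i'w; rewrite simplexW_subset; apply/forallPn; exists i'.
  rewrite !inE negb_or i'w andbT; apply: contraNneq ii' => -[->].
  by rewrite eqxx.
have [jJ j'J] : j \in J /\ j' \in J by rewrite eJ !inE !eqxx orbT.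
have [||a b c] := addj j; first by move: jJ; rewrite inE.
  by rewrite code_add_inr (negbTE (nj _ _ jj' j'J)).
have [||a' b' c'] := addj j'; first by move: j'J; rewrite inE.
  by rewrite code_add_inr (negbTE (nj j' j _ jJ)) // eq_sym.
exists (inr j |: w), (inr j' |: w); split=> //; left.
apply: contraNneq jj' => e; have := setU11 (inr j : wvertex n k) w.
by rewrite e !inE => /orP[/eqP[->]|]; [rewrite eqxx|move: jJ; rewrite inE => /negbTE->].
Qed.

End WedgeCofaces.

(** * Non-collapsibility *)

Section Chains.

Variable V : finType.
Implicit Types (s t r q : {set V}) (m K L C : {set {set V}}).

Definition boundary t : {set {set V}} := [set s : {set V} | (s \subset t) && (#|s|.+1 == #|t|)].

(** Sets of faces of one dimension are chains modulo 2, added by [symdiff]. For [r] one dimension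
    lower, this is the coefficient of [r] in the boundary of [m]. *)
Definition chain_parity m r : bool := odd #|[set s in m | r \subset s]|.

Definition symdiff m m' : {set {set V}} := (m :\: m') :|: (m' :\: m).

Lemma in_symdiff m m' s : (s \in symdiff m m') = (s \in m) (+) (s \in m').
Proof. by rewrite !inE; case: (s \in m); case: (s \in m'). Qed.

Lemma symdiff_subset m m' s : s \in symdiff m m' -> s \in m \/ s \in m'.
Proof. by rewrite in_symdiff; case: (s \in m); [left|right]. Qed.

Lemma symdiff_parity m m' r :
  chain_parity (symdiff m m') r = chain_parity m r (+) chain_parity m' r.
Proof.
rewrite /chain_parity; set A := [set s in m | _]; set A' := [set s in m' | _].
have -> : [set s in symdiff m m' | r \subset s] = (A :\: A') :|: (A' :\: A).
  apply/setP=> s; rewrite !inE.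
  by case: (s \in m); case: (s \in m'); case: (r \subset s).
rewrite cardsU (_ : _ :&: _ = set0); last first.
  by apply/setP=> s; rewrite !inE; case: (s \in m); case: (s \in m'); case: (r \subset s).
rewrite cards0 subn0 oddD -(cardsID A' A) -(cardsID A A') !oddD [A' :&: A]setIC.
by case: (odd #|A :&: A'|); case: (odd _); case: (odd _).
Qed.

(** The square of the boundary map vanishes: a face of codimension two in [t] lies in exactly two
    facets of [t]. *)
Lemma boundary_parity t r : #|r|.+2 = #|t| -> chain_parity (boundary t) r = false.
Proof.
move=> rt; rewrite /chain_parity; have [sub|nsub] := boolP (r \subset t); last first.
  rewrite (_ : [set s in _ | _] = set0) ?cards0 //; apply/setP=> s; rewrite !inE.
  apply: contraNF nsub => /andP[/andP[st _] rs]; exact: subset_trans rs st.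
suff -> : [set s in boundary t | r \subset s] = [set t :\ x | x in t :\: r].
  rewrite card_in_imset => [|x y].
    by rewrite cardsD (setIidPr sub) -rt -addn2 addKn.
  rewrite !inE => /andP[_ xt] /andP[_ yt] /setP/(_ x); rewrite !inE eqxx xt andbT /=.
  by case: eqP.
apply/setP=> s; rewrite !inE; apply/idP/imsetP => [/andP[/andP[st /eqP c] rs]|[x]].
  have /eqP/cards1P[x ex] : #|t :\: s| = 1 by rewrite cardsD (setIidPr st) -c subSnn.
  have /setDP[xt xs] : x \in t :\: s by rewrite ex set11.
  exists x; first by rewrite inE xt andbT; apply: contra xs; apply: (subsetP rs).
  by rewrite -ex setDDr setDv set0U (setIidPr st).
rewrite inE => /andP[xr xt] ->; rewrite subD1set subsetD1 sub xr andbT /=.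
by rewrite [#|t|](cardsD1 x) xt add1n eqxx.
Qed.

Lemma chain_parity_ex m r : chain_parity m r -> exists2 s, s \in m & r \subset s.
Proof.
rewrite /chain_parity => o; have : 0 < #|[set s in m | r \subset s]| by case: #|_| o.
by rewrite card_gt0 => /set0Pn[s]; rewrite inE => /andP[ms rs]; exists s.
Qed.

End Chains.

(* [F] is a single top face with free face [t]; [C1] and [C2] are top-dimensional
   pieces attached to the other facets of [F], which cannot be entered while [F]
   is present; [X] has codimension one, and its only free face [e] lies between
   the pieces attached to [C1] and [C2]. *)
Section Blocked.

Variables (V : finType) (d : nat) (K C1 C2 X : {set {set V}}) (F t s1 e : {set V}).

Implicit Types (s r q p x : {set V}) (m L C : {set {set V}}).

(** Here [d] counts the vertices of a ridge. No ridge is free in [C], except possibly those in [F],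
    for which one coface in [C] suffices because [F] is another. *)
Definition branched C : Prop :=
  forall s, s \in C -> #|s| = d ->
    exists q q', [/\ q \in C, q' \in C, #|q| = d.+1 /\ #|q'| = d.+1,
                    s \subset q /\ s \subset q' & q != q' \/ s \subset F].

Hypothesis d_gt1 : 1 < d.
Hypothesis cK : simplicial_complex K.
Hypothesis topK : forall s, s \in K -> #|s| <= d.+1.
Hypothesis topE : forall s, s \in K -> #|s| = d.+1 -> [\/ s = F, s \in C1 | s \in C2].
Hypothesis subK : [/\ C1 \subset K, C2 \subset K, X \subset K & F \in K].
Hypothesis down1 : forall s q, q \in C1 -> s \subset q -> s != set0 -> s \in C1.
Hypothesis down2 : forall s q, q \in C2 -> s \subset q -> s != set0 -> s \in C2.
Hypothesis downX : forall s q, q \in X -> s \subset q -> s != set0 -> s \in X.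
Hypothesis dis12 : forall s, d <= #|s| -> s \in C1 -> s \in C2 -> False.
Hypothesis dis1X : forall s, d <= #|s| -> s \in C1 -> s \in X -> False.
Hypothesis dis2X : forall s, d <= #|s| -> s \in C2 -> s \in X -> False.
Hypothesis branched1 : branched C1.
Hypothesis branched2 : branched C2.
Hypothesis branchedX : forall r, r \in X -> #|r|.+1 = d -> r != e ->
  exists q q', [/\ q \in X, q' \in X, #|q| = d /\ #|q'| = d,
                   r \subset q /\ r \subset q' & q != q'].
Hypothesis cardF : #|F| = d.+1.
Hypothesis FnC : F \notin C1 /\ F \notin C2.
Hypothesis tF : [/\ t \subset F, #|t| = d & t \in X].
Hypothesis s1F : [/\ s1 \subset F, #|s1| = d & s1 \in C1].
Hypothesis FC2 : forall s, s \subset F -> #|s| = d -> s != t -> s != s1 -> s \in C2.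
Hypothesis es1 : e \subset s1 /\ ~~ (e \subset t).
Hypothesis Xbig : exists2 x, x \in X & #|x| = d /\ x != t.

(** The invariant kept along a collapse. The chain in [C1] has the boundary of [s1], and the one in
    [C2] that of the remaining facets of [F] other than [t], which is the boundary of [s1] plus [t].
    The last clause says that no top face of [C1] or [C2] goes before [F]. *)
Definition blocked L : Prop :=
  [/\ simplicial_complex L /\ L \subset K,
      forall x, x \in X -> #|x| = d -> x != t -> x \in L,
      exists2 m : {set {set V}}, [/\ m \subset C1, m \subset L & forall s, s \in m -> #|s| = d] &
        forall r, #|r|.+1 = d -> chain_parity m r = (r \subset s1),
      exists2 m : {set {set V}}, [/\ m \subset C2, m \subset L & forall s, s \in m -> #|s| = d] &
        forall r, #|r|.+1 = d -> chain_parity m r = (r \subset s1) (+) (r \subset t)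
    & F \in L -> forall q, q \in C1 \/ q \in C2 -> #|q| = d.+1 -> q \in L].

Lemma card_neq0 s : 0 < #|s| -> s != set0.
Proof. by rewrite card_gt0. Qed.

(** If the chain uses the free ridge [s], adding the boundary of [q] reroutes it through the other
    facets of [q] without changing its own boundary. *)
Lemma chain_step C L m s q :
  (forall s q, q \in C -> s \subset q -> s != set0 -> s \in C) ->
  simplicial_complex L -> q \in L -> #|q| = d.+1 -> #|s| = d -> s \subset q ->
  (s \in m -> q \in C) ->
  [/\ m \subset C, m \subset L & forall s, s \in m -> #|s| = d] ->
  exists2 m' : {set {set V}}, [/\ m' \subset C, m' \subset L :\: [set s; q] &
                 forall s, s \in m' -> #|s| = d] &
    forall r, #|r|.+1 = d -> chain_parity m' r = chain_parity m r.
Proof.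
move=> downC [_ downL] Lq cq cs sq mC [mc mL md].
have nq p : #|p| = d -> p != q.
  by move=> cp; apply/eqP=> pq; move: cp; rewrite pq cq => /eqP; rewrite eqn_leq ltnn.
have [sm|sm] := boolP (s \in m); last first.
  exists m => //; split=> //; apply/subsetP=> p pm; rewrite !inE (subsetP mL) // andbT.
  by rewrite negb_or nq ?md // andbT; apply: contraNneq sm => <-.
have bq p : p \in boundary q -> [/\ p \subset q, #|p| = d & p != set0].
  rewrite inE cq eqSS => /andP[pq /eqP cp]; split=> //; apply: card_neq0.
  by rewrite cp ltnW.
exists (symdiff m (boundary q)); last first.
  by move=> r cr; rewrite symdiff_parity boundary_parity ?addbF // cq -cr.
split.
- apply/subsetP=> p /symdiff_subset[]; first exact: (subsetP mc).
  by move/bq => [pq _ p0]; apply: downC (mC sm) pq p0.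
- apply/subsetP=> p; have [->|ps] := eqVneq p s.
    by rewrite in_symdiff sm [s \in boundary q]inE sq cs cq eqxx.
  move=> pp; suff [Lp cp] : p \in L /\ #|p| = d by rewrite !inE Lp negb_or ps nq.
  case/symdiff_subset: pp => [pm|]; first by rewrite (subsetP mL) // md.
  by move/bq => [pq cp p0]; split=> //; apply: downL Lq pq p0.
- by move=> p /symdiff_subset[/md//|/bq[]].
Qed.

Lemma blocked_init : blocked K.
Proof.
have [K1 K2 KX KF] := subK; have [tsF ct tX] := tF; have [s1sF cs1 s1C] := s1F.
split=> //.
- by move=> x xX _ _; apply: (subsetP KX).
- exists [set s1]; first split.
  + by rewrite sub1set.
  + by rewrite sub1set (subsetP K1).
  + by move=> s /set1P->.
  + move=> r _; rewrite /chain_parity; case: (boolP (r \subset s1)) => h.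
      rewrite (_ : [set s in _ | _] = [set s1]) ?cards1 //.
      by apply/setP=> s; rewrite !inE; case: eqP => // ->.
    rewrite (_ : [set s in _ | _] = set0) ?cards0 //.
    by apply/setP=> s; rewrite !inE; case: eqP => // ->; apply/negbTE.
- have ts1 : t != s1.
    by apply/eqP=> e1; apply: (@dis1X t); rewrite ?ct // e1.
  have mem p : p \in boundary F :\: [set t; s1] -> [/\ p \in C2 & #|p| = d].
    rewrite !inE negb_or cardF eqSS => /andP[/andP[pt ps1] /andP[pF /eqP cp]].
    by split=> //; apply: FC2.
  exists (boundary F :\: [set t; s1]); first split.
  + by apply/subsetP=> p /mem[].
  + by apply/subsetP=> p /mem[pC _]; apply: (subsetP K2).
  + by move=> p /mem[].
  + move=> r cr; have := @boundary_parity _ F r; rewrite cardF -cr => /(_ erefl).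
    (* The boundary of [F] is the chosen chain plus [t] plus [s1], and it is a cycle. *)
    have eF : boundary F = symdiff (boundary F :\: [set t; s1]) (symdiff [set t] [set s1]).
      apply/setP=> p; rewrite !inE; have [->|pt] := eqVneq p t.
        by rewrite tsF cardF ct eqxx (negbTE ts1).
      have [->|ps] := eqVneq p s1; first by rewrite s1sF cardF cs1 eqxx.
      by rewrite !andbF !orbF.
    have one p : chain_parity [set p] r = (r \subset p).
      rewrite /chain_parity; case: (boolP (r \subset p)) => h.
        rewrite (_ : [set s in _ | _] = [set p]) ?cards1 //.
        by apply/setP=> s; rewrite !inE; case: eqP => // ->.
      rewrite (_ : [set s in _ | _] = set0) ?cards0 //.
      by apply/setP=> s; rewrite !inE; case: eqP => // ->; apply/negbTE.
    rewrite {1}eF !symdiff_parity !one.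
    by case: (chain_parity _ _); case: (r \subset s1); case: (r \subset t).
- by move=> _ q [qC|qC] _; [apply: (subsetP K1)|apply: (subsetP K2)].
Qed.

(** If [q] is smaller than a ridge, nothing in the invariant is touched. If [q] is a ridge, the
    prescribed boundaries exclude it from both chains and from [X], unless it is [t]. If [q] is a
    top face, [chain_step] repairs the chains. *)
Lemma blocked_step L L' : blocked L -> elementary_collapse L L' -> blocked L'.
Proof.
move=> [[cL LK] HX [m1 M1 P1] [m2 M2 P2] HF] LL'.
have cL' := elementary_collapse_complex cL LL'.
have [s [q [Ls Lq free eL']]] := elementary_collapseP _ _ LL'.
have [_ sq uq] := free_faceP free.
have cq := free_face_card cL Ls free.
have [tsF ct tX] := tF; have [s1sF cs1 s1C] := s1F.
have L'K : L' \subset K by rewrite eL' (subset_trans (subsetDl _ _)).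
have keep p : p \in L -> p != s -> p != q -> p \in L'.
  by move=> Lp ps pq; rewrite eL' !inE Lp negb_or ps pq.
have s0 : s != set0 by apply: contraTneq Ls => ->; have [] := cL.
have [lt|ge] := ltnP #|q| d.
  have keepd p : p \in L -> d <= #|p| -> p \in L'.
    move=> Lp cp; apply: keep => //; apply/eqP=> e'; move: cp; rewrite e' leqNgt ?lt //.
    by rewrite (ltn_trans _ lt) // cq.
  split=> //.
  - by move=> x xX cx xt; apply: keepd; rewrite ?cx //; apply: HX.
  - exists m1 => //; case: M1 => a b c; split=> //.
    by apply/subsetP=> p pm; apply: keepd; rewrite ?(subsetP b) // c.
  - exists m2 => //; case: M2 => a b c; split=> //.
    by apply/subsetP=> p pm; apply: keepd; rewrite ?(subsetP b) // c.
  - move=> L'F p pC cp; apply: keepd; rewrite ?cp //; apply: HF => //.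
    by move: L'F; rewrite eL' inE => /andP[].
have [M1C M1L M1d] := M1; have [M2C M2L M2d] := M2.
move: ge; rewrite leq_eqVlt => /orP[/eqP cqd|cqd].
  have cs : #|s|.+1 = d by rewrite cqd cq.
  have u p : p \in L -> #|p| = d -> s \subset p -> p = q.
    by move=> Lp cp sp; apply: uq => //; rewrite properEcard sp cp -cs ltnSn.
  (* As [q] is the only ridge of [L] over [s], a chain containing [q] has [s] in its boundary. *)
  have only m : m \subset L -> (forall p, p \in m -> #|p| = d) -> q \in m ->
      chain_parity m s.
    move=> mL md qm; rewrite /chain_parity (_ : [set p in m | _] = [set q]) ?cards1 //.
    apply/setP=> p; rewrite !inE; apply/andP/eqP => [[pm sp]|->].
      by apply: u; rewrite ?(subsetP mL) ?md.
    by rewrite qm proper_sub.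
  (* Since [e] is not in [t], [s] has two cofaces in [X]; one is not [t], is still present, and so
     is [q]. *)
  have coX : s \subset t -> exists x, [/\ x \in X, #|x| = d, x = q & x != t].
    move=> st; have sX : s \in X by apply: downX tX st s0.
    have se : s != e by apply: contraTneq st => ->; case: es1.
    have [x [x' [xX x'X [cx cx'] [sx sx'] xx']]] := branchedX sX cs se.
    have [ext|xt] := eqVneq x t.
      have xt : x' != t by rewrite eq_sym -ext.
      by exists x'; split=> //; apply: u => //; apply: HX.
    by exists x; split=> //; apply: u => //; apply: HX.
  have co1 : s \subset s1 -> q \in C1.
    rewrite -P1 // => /chain_parity_ex[p pm sp].
    by rewrite -(u p (subsetP M1L p pm) (M1d p pm) sp) (subsetP M1C).
  have co2 : (s \subset s1) (+) (s \subset t) -> q \in C2.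
    rewrite -P2 // => /chain_parity_ex[p pm sp].
    by rewrite -(u p (subsetP M2L p pm) (M2d p pm) sp) (subsetP M2C).
  (* If [q] were in [m1], then [s] would lie in [s1]; the face [q] would also be in [X] if [s] lies
     in [t], and in [C2] otherwise, against disjointness. *)
  have qm1 : q \notin m1.
    apply/negP=> qm; have qC := subsetP M1C q qm.
    have := only _ M1L M1d qm; rewrite P1 // => ss1.
    have [st|st] := boolP (s \subset t).
      have [x [xX _ exq _]] := coX st; apply: (@dis1X q) => //; first by rewrite cqd.
      by rewrite -exq.
    by apply: (@dis12 q) => //; rewrite ?cqd // co2 // ss1 (negbTE st).
  have qm2 : q \notin m2.
    apply/negP=> qm; have qC := subsetP M2C q qm.
    have := only _ M2L M2d qm; rewrite P2 //.
    have [ss1 _|ss1 /= st] := boolP (s \subset s1).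
      by apply: (@dis12 q); rewrite ?cqd // co1.
    have [x [xX _ exq _]] := coX st; apply: (@dis2X q) => //; first by rewrite cqd.
    by rewrite -exq.
  (* Two surviving cofaces of [s] in [X] would contradict freeness. If [s] is [e] or one coface is
     [t], then a chain has [s] in its boundary, which puts [q] in [C1] or [C2]. *)
  have qX : q \in X -> q = t.
    move=> qX; apply/eqP; apply: contraT => qt; exfalso.
    have sX : s \in X by apply: downX qX (proper_sub sq) s0.
    have [se|se] := eqVneq s e.
      by apply: (@dis1X q); rewrite ?cqd // co1 // se; case: es1.
    have [x [x' [xX x'X [cx cx'] [sx sx'] xx']]] := branchedX sX cs se.
    have [ext|xt] := eqVneq x t.
      rewrite ext in sx; have [ss1|ss1] := boolP (s \subset s1).
        by apply: (@dis1X q); rewrite ?cqd // co1.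
      by apply: (@dis2X q); rewrite ?cqd // co2 // (negbTE ss1) sx.
    have [ext'|xt'] := eqVneq x' t.
      rewrite ext' in sx'; have [ss1|ss1] := boolP (s \subset s1).
        by apply: (@dis1X q); rewrite ?cqd // co1.
      by apply: (@dis2X q); rewrite ?cqd // co2 // (negbTE ss1) sx'.
    by case/eqP: xx'; rewrite (u _ (HX _ xX cx xt) cx sx) (u _ (HX _ x'X cx' xt') cx' sx').
  have nsd p : d <= #|p| -> p != s.
    by move=> cp; apply/eqP=> ps; move: cp; rewrite ps leqNgt -cs ltnSn.
  split=> //.
  - move=> x xX cx xt; apply: keep; rewrite ?nsd ?cx ?HX //.
    by apply: contraNneq xt => xq; apply/eqP; rewrite xq; apply: qX; rewrite -xq.
  - exists m1 => //; split=> //; apply/subsetP=> p pm.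
    by apply: keep; rewrite ?(subsetP M1L) ?nsd ?M1d //; apply: contraNneq qm1 => <-.
  - exists m2 => //; split=> //; apply/subsetP=> p pm.
    by apply: keep; rewrite ?(subsetP M2L) ?nsd ?M2d //; apply: contraNneq qm2 => <-.
  - move=> L'F p pC cp; have dp : p != q.
      by apply/eqP=> pq; move: cp; rewrite pq -cqd => /eqP; rewrite eqn_leq ltnn andbF.

    apply: keep; rewrite ?nsd ?cp //; apply: HF => //.
    by move: L'F; rewrite eL' inE => /andP[].
have cqD : #|q| = d.+1.
  by apply/eqP; rewrite eqn_leq cqd andbT topK // (subsetP LK).
have cs : #|s| = d by move: cqD; rewrite cq => -[].
have u p : p \in L -> #|p| = d.+1 -> s \subset p -> p = q.
  by move=> Lp cp sp; apply: uq => //; rewrite properEcard sp cp cs ltnSn.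
have sXt x : x \in X -> #|x| = d -> x != t -> s != x -> x \in L'.
  move=> xX cx xt sx; apply: keep; rewrite ?HX // 1?eq_sym //.
  by apply/eqP=> xq; move: cx; rewrite -xq cqD => /eqP; rewrite eqn_leq ltnn.
(* While [F] is present, a ridge of [C1] or [C2] has two top cofaces in [L], one of them possibly
   [F]; so the first top face to go is [F]. *)
have guard : F \in L -> q != F -> False.
  move=> LF qF.
  have both C : branched C -> (forall p, p \in C -> #|p| = d.+1 -> p \in L) ->
      (forall s q, q \in C -> s \subset q -> s != set0 -> s \in C) -> q \in C -> False.
    move=> br CL dn qC; have sC := dn _ _ qC (proper_sub sq) s0.
    have [p [p' [pC p'C [cp cp'] [sp sp'] [pp'|sF]]]] := br s sC cs.
      by case/eqP: pp'; rewrite (u _ (CL _ pC cp) cp sp) (u _ (CL _ p'C cp') cp' sp').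
    by case/eqP: qF; rewrite (u _ LF cardF sF).
  have [qF'|qC|qC] := topE (subsetP LK _ Lq) cqD; first by rewrite qF' eqxx in qF.
    by apply: both branched1 _ down1 qC => p pC; apply: (HF LF); left.
  by apply: both branched2 _ down2 qC => p pC; apply: (HF LF); right.
(* The ridge lost in this step is [t] or lies in a piece disjoint from the ridges of [X], so the
   clause on [X] survives. *)
have st_or : s = t \/ s \in C1 \/ s \in C2.
  have [qF'|qC|qC] := topE (subsetP LK _ Lq) cqD.
  - have sF : s \subset F by rewrite -qF' proper_sub.
    have [->|st] := eqVneq s t; first by left.
    have [->|ss1] := eqVneq s s1; first by right; left.
    by right; right; apply: FC2.
  - by right; left; apply: down1 qC (proper_sub sq) s0.
  - by right; right; apply: down2 qC (proper_sub sq) s0.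
(* A ridge of [C] cannot be paired with [F]: it has a coface in [C], still present as long as [F]
   is. Hence [F] can only be entered through [t]. *)
have sC_q C : branched C -> (forall p, p \in C -> #|p| = d.+1 -> F \in L -> p \in L) ->
    F \notin C -> s \in C -> q <> F.
  move=> br CL FC sC qF; have LF : F \in L by rewrite -qF.
  have [p [_ [pC _ [cp _] [sp _] _]]] := br s sC cs.
  by case/negP: FC; rewrite -qF -(u _ (CL _ pC cp LF) cp sp).
have nF1 : s \in C1 -> q <> F.
  by apply: (sC_q _ branched1); [move=> p pC cp LF; apply: HF => //; left|case: FnC].
have nF2 : s \in C2 -> q <> F.
  by apply: (sC_q _ branched2); [move=> p pC cp LF; apply: HF => //; right|case: FnC].
split=> //.
- move=> x xX cx xt; apply: sXt => //; apply/eqP=> sx; case: st_or => [st|[sC|sC]].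
  + by rewrite -sx st eqxx in xt.
  + by apply: (@dis1X s); rewrite ?cs // sx.
  + by apply: (@dis2X s); rewrite ?cs // sx.
- have [|m Mm Pm] := @chain_step C1 L m1 s q down1 cL Lq cqD cs (proper_sub sq) _ M1.
    move=> sm; have sC := subsetP M1C s sm.
    have [//|//|qC] := topE (subsetP LK _ Lq) cqD; first by move/(nF1 sC).
    by exfalso; apply: (@dis12 s); rewrite ?cs //; apply: down2 qC (proper_sub sq) s0.
  by exists m; [rewrite eL'|move=> r cr; rewrite Pm // P1].
- have [|m Mm Pm] := @chain_step C2 L m2 s q down2 cL Lq cqD cs (proper_sub sq) _ M2.
    move=> sm; have sC := subsetP M2C s sm.
    have [//|qC|//] := topE (subsetP LK _ Lq) cqD; first by move/(nF2 sC).
    by exfalso; apply: (@dis12 s); rewrite ?cs //; apply: down1 qC (proper_sub sq) s0.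
  by exists m; [rewrite eL'|move=> r cr; rewrite Pm // P2].
- rewrite eL' !inE negb_or => /andP[/andP[Fs Fq] LF].
  by exfalso; apply: (guard LF); rewrite eq_sym.
Qed.

(** A ridge of [X] other than [t] survives every step, but it has [d > 1] vertices. *)
Lemma not_collapsible : ~ collapsible K.
Proof.
move=> [v /connectP[p pp eL]].
have : blocked [set [set v]].
  rewrite eL; elim: p K pp blocked_init {eL} => //= L p IH K' /andP[KL pp] bK.
  exact: IH pp (blocked_step bK KL).
move=> [_ HX _ _ _]; have [x xX [cx xt]] := Xbig.
have := HX x xX cx xt; rewrite inE => /eqP ex.
by move: d_gt1; rewrite -cx ex cards1.
Qed.

End Blocked.

(** * From finite checks on the base to its wedges *)

Definition piece_ok n (F : seq nat) (C : seq (seq nat)) : bool :=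
  [&& all (fun s => size s <= 4) C, F \notin C &
   all (fun s => (size s == 3) ==>
     (0 < size (cofaces n C s)) && ((1 < size (cofaces n C s)) || subface s F)) C].

(** For a face through the replaced vertex, [wtop] is the only face of the wedge with its code, so
    equalities and inclusions can be read on codes. *)
Definition apex_face n m (s : seq nat) : Prop :=
  [/\ wf_face n s, n.+1 \in s & size s = m].

(** Computable conditions on the base that give the hypotheses of [not_collapsible] for every wedge,
    with [d = k.+3]. The faces [fF], [ft], [fs], [fe] yield [F], [t], [s1], [e], and [fx] is the
    surviving ridge of [X]. *)
Record valid_pieces n (LK L1 L2 LX : seq (seq nat)) (fF ft fs fe fx : seq nat) : Prop :=
  ValidPieces {
  vp_closedK : closed_list n LK;
  vp_closed1 : closed_list n L1;
  vp_closed2 : closed_list n L2;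
  vp_closedX : closed_list n LX;
  vp_piece1 : piece_ok n fF L1;
  vp_piece2 : piece_ok n fF L2;
  vp_X_size : all (fun s => size s <= 3) LX;
  vp_X_cofaces : all (fun s => (size s == 2) ==> (s != fe) ==> (1 < size (cofaces n LX s))) LX;
  vp_K_top : all (fun s => (size s <= 4) && ((size s == 4) ==>
    (s == fF) || (s \in L1) || (s \in L2))) LK;
  vp_sub_K : all (fun s => s \in LK) (fF :: L1 ++ L2 ++ LX);
  vp_disjoint1 : all (fun s => (2 < size s) ==> (s \notin L2) && (s \notin LX)) L1;
  vp_disjoint2 : all (fun s => (2 < size s) ==> (s \notin LX)) L2;
  vp_F_facets : all (fun s => (2 < size s) && subface s fF ==>
    (s \in [:: fF; ft; fs]) || (s \in L2)) LK;
  vp_fF_ok : apex_face n 4 fF;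
  vp_ft_ok : [/\ apex_face n 3 ft, ft \in LX & subface ft fF];
  vp_fs_ok : [/\ apex_face n 3 fs, fs \in L1 & subface fs fF];
  vp_fe_ok : [/\ apex_face n 2 fe, subface fe fs & ~~ subface fe ft];
  vp_fx_ok : [/\ apex_face n 3 fx, fx \in LX & fx != ft];
}.

Section Pieces.

Variables (n k : nat) (LK L1 L2 LX : seq (seq nat)) (fF ft fs fe fx : seq nat).

Hypothesis valid : valid_pieces n LK L1 L2 LX fF ft fs fe fx.

Let closedK := vp_closedK valid.
Let closed1 := vp_closed1 valid.
Let closed2 := vp_closed2 valid.
Let closedX := vp_closedX valid.
Let piece1 := vp_piece1 valid.
Let piece2 := vp_piece2 valid.
Let X_size := vp_X_size valid.
Let X_cofaces := vp_X_cofaces valid.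
Let K_top := vp_K_top valid.
Let sub_K := vp_sub_K valid.
Let disjoint1 := vp_disjoint1 valid.
Let disjoint2 := vp_disjoint2 valid.
Let F_facets := vp_F_facets valid.
Let fF_ok := vp_fF_ok valid.
Let ft_ok := vp_ft_ok valid.
Let fs_ok := vp_fs_ok valid.
Let fe_ok := vp_fe_ok valid.
Let fx_ok := vp_fx_ok valid.

Notation V := (wvertex n k).
Notation wedgeK := (wedge n k).
Notation topK := (wtop n k).

Definition example : {set {set V}} := wedgeK LK.

Lemma example_complex : simplicial_complex example.
Proof. exact: wedge_complex. Qed.

Lemma mem_wtop B s : wf_face n s -> s != [::] -> s \in B -> topK s \in wedgeK B.
Proof.
move=> wfs s0 sB; rewrite inE inE code_wtop // sB orbT andbT.
by apply: code_neq0; rewrite code_wtop.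
Qed.

Lemma mem_wedge_big B w : w \in wedgeK B -> k < #|w| -> code w \in B.
Proof.
rewrite inE => /andP[_]; rewrite inE => /orP[/eqP e|//] h.
by have := card_le_code w; rewrite e leqNgt h.
Qed.

Lemma subset_fF (w : {set V}) : (w \subset topK fF) = subface (code w) fF.
Proof.
have [wf nF _] := fF_ok; apply/idP/idP => [/code_subset|]; first by rewrite code_wtop.
exact: subset_wtop.
Qed.

Lemma piece_branched C : piece_ok n fF C ->
  branched k.+3 (topK fF) (wedgeK C).
Proof.
case/and3P=> sz _ /allP br w wC cw.
have cC : code w \in C by apply: mem_wedge_big => //; rewrite cw; exact: leq_addl 2 k.+1.
have hb : size (code w) = 3 -> 0 < size (cofaces n C (code w)) /\
    (1 < size (cofaces n C (code w)) \/ w \subset topK fF).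
  move=> s3; have := br _ cC; rewrite s3 /= -subset_fF => /andP[-> h].
  by split=> //; apply/orP.
exact: wedge_cofaces sz cw cC hb.
Qed.

Lemma size_code_big (w : {set V}) : k.+3 <= #|w| -> 2 < size (code w).
Proof. by move=> h; have := leq_trans h (card_le_code w); rewrite -add3n leq_add2r. Qed.

Lemma mem_wedge_code B (w : {set V}) : 0 < #|w| -> code w \in B -> w \in wedgeK B.
Proof. by rewrite card_gt0 => w0 cB; rewrite inE w0 inE cB orbT. Qed.

Lemma piece_subset C : {subset C <= fF :: L1 ++ L2 ++ LX} ->
  wedgeK C \subset example.
Proof.
by move=> CB; apply: wedge_subset => s /CB; apply: (allP sub_K).
Qed.

Lemma face_F_example : topK fF \in example.
Proof.
have [wf nF _] := fF_ok; apply: mem_wtop => //; last exact: (allP sub_K _ (mem_head _ _)).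
by apply: contraTneq nF => ->.
Qed.

Lemma example_card w : w \in example -> #|w| <= k.+4.
Proof.
move=> /mem_wedge_big wK; case: (leqP #|w| k) => [h|/wK cw].
  exact: leq_trans h (leq_addl 4 k).
have /andP[h _] := allP K_top _ cw; apply: leq_trans (card_le_code w) _.
exact: leq_add h (leqnn k).
Qed.

Lemma example_top (w : {set V}) : w \in example -> #|w| = k.+4 ->
  [\/ w = topK fF, w \in wedgeK L1 | w \in wedgeK L2].
Proof.
move=> wK cw; have kw : k < #|w| by rewrite cw; exact: leq_addl 3 k.+1.
have cK := mem_wedge_big wK kw; have /andP[s4 /implyP h] := allP K_top _ cK.
have : size (code w) == 4.
  rewrite eqn_leq s4 /=; by have := card_le_code w; rewrite cw -add4n leq_add2r.
have w0 : 0 < #|w| by rewrite cw.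
move=> /h /orP[/orP[/eqP e|e]|e].
- by constructor 1; apply: wtop_unique => //; case: fF_ok.
- by constructor 2; apply: mem_wedge_code.
- by constructor 3; apply: mem_wedge_code.
Qed.

Lemma pieces_disjoint C C' (w : {set V}) :
  {in C, forall s, (2 < size s) ==> (s \notin C')} -> k.+3 <= #|w| ->
  w \in wedgeK C -> w \in wedgeK C' -> False.
Proof.
move=> dis cw wC wC'; have kw : k < #|w| by apply: leq_trans cw; exact: leq_addl 2 k.+1.
have := dis _ (mem_wedge_big wC kw).
by rewrite size_code_big // (mem_wedge_big wC' kw).
Qed.

(** The alternative [P] of [wedge_cofaces] is [False], as two cofaces are wanted. The only excepted
    code is [fe], and [topK fe] is the only face with that code. *)
Lemma X_branched (r : {set V}) : r \in wedgeK LX -> #|r|.+1 = k.+3 ->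
  r != topK fe -> exists q q',
    [/\ q \in wedgeK LX, q' \in wedgeK LX, #|q| = k.+3 /\ #|q'| = k.+3,
        r \subset q /\ r \subset q' & q != q'].
Proof.
move=> rX [cr] re; have cX : code r \in LX.
  by apply: mem_wedge_big => //; rewrite cr; exact: leq_addl 1 k.+1.
have hb : size (code r) = 2 -> 0 < size (cofaces n LX (code r)) /\
    (1 < size (cofaces n LX (code r)) \/ False).
  move=> s2; have := allP X_cofaces _ cX; rewrite s2 /=; case: eqP => [ce|_] /=.
    by case/eqP: re; apply: wtop_unique => //; case: fe_ok => -[].
  by move=> h; split; [apply: ltnW|left].
have [q [q' [a b c e [f|//]]]] := @wedge_cofaces n k 2 _ r False X_size cr cX hb.
by exists q, q'.
Qed.

Lemma facets_of_F (w : {set V}) : w \subset topK fF -> #|w| = k.+3 ->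
  w != topK ft -> w != topK fs -> w \in wedgeK L2.
Proof.
move=> wF cw wt ws; have w0 : 0 < #|w| by rewrite cw.
have wK : w \in example.
  case: example_complex => _ down; apply: down face_F_example wF _.
  by rewrite -card_gt0.
have cwF : subface (code w) fF by rewrite -subset_fF.
have cK : code w \in LK by apply: mem_wedge_big => //; rewrite cw; exact: leq_addl 2 k.+1.
have := allP F_facets _ cK; rewrite cwF size_code_big ?cw //=.
case/orP=> [|e]; last exact: mem_wedge_code.
rewrite !inE => /or3P[]/eqP e.
- have [wf nF sF] := fF_ok; have ew : w = topK fF by apply: wtop_unique.
  by move: cw; rewrite ew card_wtop // sF => /eqP; rewrite -[4 + k]/(k.+4) eqn_leq ltnn.
- by case/eqP: wt; apply: wtop_unique => //; case: ft_ok => -[].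
- by case/eqP: ws; apply: wtop_unique => //; case: fs_ok => -[].
Qed.

Lemma face_F_piece C : piece_ok n fF C -> topK fF \notin wedgeK C.
Proof.
have [wf nF sF] := fF_ok; case/and3P=> _ FC _; apply: contra FC => /mem_wedge_big.
by rewrite code_wtop //; apply; rewrite card_wtop // sF; exact: leq_addl 3 k.+1.
Qed.

Lemma card_apex m s : apex_face n m s -> #|topK s| = m + k.
Proof. by case=> wf _ <-; apply: card_wtop. Qed.

Lemma mem_apex m s C : apex_face n m s -> s \in C -> topK s \in wedgeK C.
Proof. by case=> wf ns _; apply: mem_wtop => //; apply: contraTneq ns => ->. Qed.

Lemma apex_subset m m' s r : apex_face n m s -> apex_face n m' r ->
  (topK s \subset topK r) = subface s r.
Proof.
move=> [wfs ns _] [wfr nr _]; apply/idP/idP => [/code_subset|]; first by rewrite !code_wtop.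
exact: wtop_subset.
Qed.

Lemma example_not_collapsible : ~ collapsible example.
Proof.
have [aT tX tF] := ft_ok; have [aS sC1 sF] := fs_ok; have [aE es et] := fe_ok.
have [aX xX xt] := fx_ok; have aF := fF_ok.
have d12 : {in L1, forall s, (2 < size s) ==> (s \notin L2)}.
  by move=> s /(allP disjoint1); case: (2 < size s) => //= /andP[].
have d1X : {in L1, forall s, (2 < size s) ==> (s \notin LX)}.
  by move=> s /(allP disjoint1); case: (2 < size s) => //= /andP[].
apply: (@not_collapsible V k.+3 example (wedgeK L1) (wedgeK L2)
  (wedgeK LX) (topK fF) (topK ft) (topK fs) (topK fe)).
- by [].
- exact: example_complex.
- exact: example_card.
- exact: example_top.
- by split; last exact: face_F_example;
     apply: piece_subset => s sC; rewrite inE !mem_cat sC ?orbT.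
- by move=> s q qC sq s0; apply: wedge_down sq s0.
- by move=> s q qC sq s0; apply: wedge_down sq s0.
- by move=> s q qC sq s0; apply: wedge_down sq s0.
- by move=> w; apply: pieces_disjoint.
- by move=> w; apply: pieces_disjoint.
- by move=> w; apply: pieces_disjoint; apply: allP disjoint2.
- exact: piece_branched.
- exact: piece_branched.
- exact: X_branched.
- exact: card_apex aF.
- by split; apply: face_F_piece.
- by split; [rewrite (apex_subset aT aF)|exact: card_apex aT|exact: mem_apex aT tX].
- by split; [rewrite (apex_subset aS aF)|exact: card_apex aS|exact: mem_apex aS sC1].
- exact: facets_of_F.
- by rewrite (apex_subset aE aS) (apex_subset aE aT).
- exists (topK fx); first exact: mem_apex aX xX.
  split; first exact: card_apex aX.
  apply: contraNneq xt => /(congr1 (@code n k)); case: aX aT => [wx _ _] [wt _ _].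
  by rewrite !code_wtop // => ->.
Qed.

Lemma example_dim : complex_dim example = k.+3.
Proof.
apply/eqP; rewrite eqn_leq; apply/andP; split.
  by apply/bigmax_leqP => w /example_card; rewrite /face_dim; case: #|w|.
by apply: leq_trans (leq_bigmax_cond _ face_F_example); rewrite /face_dim (card_apex fF_ok).
Qed.

(** Lifting adds [k] to the dimension of a critical face, and [W0] is the critical vertex; these
    three critical faces meet the lower bound [critical_card_ge3]. *)
Lemma example_optimal (R : realDomainType) c (s r : seq nat) :
  reduces n LK c [:: [:: n.+1]] ->
  critical_of n k c = topK s |: (topK r |: [set [set W0 n k]]) ->
  wf_face n s -> wf_face n r -> 1 < size s -> 1 < size r -> size s != size r ->
  optimal_morse_vector R example
    [seq (i == 0) + (i == (size s + k).-1) + (i == (size r + k).-1) | i <- iota 0 k.+4].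
Proof.
move=> red ec ws wr s1 r1 sr.
have [N [h [_ dm cf]]] := reduces_critical R example_complex red.
pose f (s : {set V}) : R := (h s)%:R%R; rewrite ec in cf.
have [cs cr] := (card_wtop k ws, card_wtop k wr).
have n1 : topK s != topK r.
  by apply/eqP=> /(congr1 (fun w : {set V} => #|w|)); rewrite cs cr; clear -sr; lia.
have n2 : topK s != [set W0 n k].
  by apply/eqP=> /(congr1 (fun w : {set V} => #|w|)); rewrite cs cards1; clear -s1; lia.
have n3 : topK r != [set W0 n k].
  by apply/eqP=> /(congr1 (fun w : {set V} => #|w|)); rewrite cr cards1; clear -r1; lia.
exists f; split=> //.
  rewrite /morse_vector example_dim; apply: eq_map => i; rewrite cf.
  rewrite -sum1_card.
  pose C := topK s |: (topK r |: [set [set W0 n k]]).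
  rewrite (eq_bigl (fun w => (w \in C) && (face_dim w == i))); last first.
    by move=> w; rewrite inE.
  rewrite big_mkcondr /= big_setU1 ?inE ?negb_or ?n1 //= big_setU1 ?inE //= big_set1.
  by rewrite /face_dim cs cr cards1 ![i == _]eq_sym /=; do 3!case: (_ == i).
move=> g dg; rewrite cf !cardsU1 !inE negb_or n1 n2 n3 cards1.
apply: (critical_card_ge3 example_complex example_not_collapsible dm _ dg).
by rewrite cf !cardsU1 !inE negb_or n1 n2 n3 cards1.
Qed.

End Pieces.

(** Here [p] and [q] are positions within the last three entries; [k] zeros separate these from the
    first entry. *)
Lemma indicator_vector k (p q : nat) :
  [seq (i == 0) + (i == p + k.+1) + (i == q + k.+1) | i <- iota 0 k.+4] =
  1 :: nseq k 0 ++ [seq (i == p) + (i == q) | i <- iota 0 3].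
Proof.
have -> : iota 0 k.+4 = 0 :: iota 1 k ++ iota k.+1 3.
  by rewrite -[k.+4]/(3 + k).+1 addnC -(iotaD 1 k 3).
rewrite map_cons map_cat eqxx !addnS /=; congr (_ :: _ ++ _).
  set s := [seq _ | i <- iota 1 k].
  have /all_pred1P -> : all (pred1 0) s; last by rewrite size_map size_iota.
  rewrite all_map; apply/allP=> i; rewrite mem_iota => ik /=.
  by clear -ik; lia.
by congr [:: _; _; _]; lia.
Qed.

(** * The 3-dimensional complex *)

(* Found by computer search.  The vertex replaced by a simplex is 18, and 17 is the
   apex of the cone used for contractibility.  Both 3-dimensional pieces come from the
   same 7-vertex triangulated 2-complex with one free edge: [C1] is its wedge at an
   end of this edge, [C2] its suspension with the poles 2 and 18. *)
Definition facets_C1 : seq (seq nat) :=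
  [::
   [:: 0; 2; 7; 8]; [:: 0; 2; 7; 10]; [:: 0; 2; 8; 10]; [:: 0; 2; 8; 11];
   [:: 0; 2; 11; 18]; [:: 0; 7; 8; 18]; [:: 0; 7; 10; 18]; [:: 0; 8; 10; 18];
   [:: 0; 8; 11; 18]; [:: 2; 7; 8; 18]; [:: 2; 7; 9; 11]; [:: 2; 7; 9; 18];
   [:: 2; 7; 10; 11]; [:: 2; 8; 9; 11]; [:: 2; 8; 9; 18]; [:: 2; 8; 10; 18];
   [:: 2; 10; 11; 18]; [:: 7; 9; 11; 18]; [:: 7; 10; 11; 18]; [:: 8; 9; 11; 18]].

Definition facets_C2 : seq (seq nat) :=
  [::
   [:: 0; 1; 2; 16]; [:: 0; 1; 16; 18]; [:: 0; 2; 12; 13]; [:: 0; 2; 12; 15];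
   [:: 0; 2; 13; 15]; [:: 0; 2; 13; 16]; [:: 0; 12; 13; 18]; [:: 0; 12; 15; 18];
   [:: 0; 13; 15; 18]; [:: 0; 13; 16; 18]; [:: 1; 2; 12; 13]; [:: 1; 2; 12; 14];
   [:: 1; 2; 13; 14]; [:: 1; 2; 13; 15]; [:: 1; 2; 15; 16]; [:: 1; 12; 13; 18];
   [:: 1; 12; 14; 18]; [:: 1; 13; 14; 18]; [:: 1; 13; 15; 18]; [:: 1; 15; 16; 18];
   [:: 2; 12; 14; 16]; [:: 2; 12; 15; 16]; [:: 2; 13; 14; 16]; [:: 12; 14; 16; 18];
   [:: 12; 15; 16; 18]; [:: 13; 14; 16; 18]].

Definition facets_X : seq (seq nat) :=
  [::
   [:: 0; 3; 4]; [:: 0; 3; 5]; [:: 0; 3; 6]; [:: 0; 4; 5]; [:: 0; 6; 18]; [:: 1; 2; 6];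
   [:: 1; 2; 18]; [:: 1; 3; 6]; [:: 1; 3; 18]; [:: 2; 3; 5]; [:: 2; 3; 18]; [:: 2; 5; 6];
   [:: 3; 4; 18]; [:: 4; 5; 6]; [:: 4; 6; 18]].

(** The pair of [face_t] and [face_F] goes first, then the tetrahedra of [C2] and of [C1]. The
    critical triangle breaks the membranes; the critical edge breaks the circle on 0, 4, 18 onto
    which the rest collapses. *)
Definition cert_110 : seq (seq nat * option nat) :=
  [::
   ([:: 1; 2; 18], Some 0); ([:: 0; 1], Some 16); ([:: 1; 16], Some 15);
   ([:: 1; 15], Some 13); ([:: 0; 16], Some 13); ([:: 13; 15], Some 0); ([:: 15], Some 12);
   ([:: 16], Some 14); ([:: 14], Some 1); ([:: 12], Some 13); ([:: 0; 2; 18], Some 11);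
   ([:: 0; 11], Some 8); ([:: 8; 11], Some 9); ([:: 9; 11], Some 7); ([:: 11], Some 10);
   ([:: 9], Some 2); ([:: 7; 10], Some 0); ([:: 7], Some 8); ([:: 10], Some 8);
   ([:: 1; 13; 18], None); ([:: 1; 13], Some 2); ([:: 13], Some 0); ([:: 0; 2], Some 8);
   ([:: 8], Some 18); ([:: 1; 2], Some 6); ([:: 1], Some 3); ([:: 2; 6], Some 5);
   ([:: 2], Some 3); ([:: 3; 18], Some 4); ([:: 3], Some 0); ([:: 5], Some 4);
   ([:: 6], Some 18); ([:: 4; 18], None); ([:: 4], Some 0); ([:: 0], Some 18)].

(** With [face_F] critical, [face_t] stays. The triangle [0; 8; 18] of [C1] is critical, and [X] is
    then collapsed starting from its free edge [face_e]. *)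
Definition cert_011 : seq (seq nat * option nat) :=
  [::
   ([:: 0; 1; 2; 18], None); ([:: 0; 1], Some 16); ([:: 1; 16], Some 15);
   ([:: 0; 16], Some 13); ([:: 1; 15], Some 13); ([:: 15; 16], Some 12);
   ([:: 16], Some 14); ([:: 14], Some 1); ([:: 15], Some 0); ([:: 13], Some 12);
   ([:: 0; 2; 18], Some 11); ([:: 0; 11], Some 8); ([:: 8; 11], Some 9);
   ([:: 9; 11], Some 7); ([:: 9], Some 2); ([:: 11], Some 10); ([:: 7; 10], Some 0);
   ([:: 10], Some 8); ([:: 7], Some 8); ([:: 0; 8; 18], None); ([:: 8], Some 2);
   ([:: 0; 2], Some 12); ([:: 2; 12], Some 1); ([:: 12], Some 18); ([:: 0; 18], Some 6);
   ([:: 6; 18], Some 4); ([:: 4; 6], Some 5); ([:: 4; 18], Some 3); ([:: 4], Some 0);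
   ([:: 0], Some 3); ([:: 5], Some 2); ([:: 6], Some 1); ([:: 1], Some 18);
   ([:: 3], Some 2); ([:: 2], Some 18)].

(** Every entry contains the apex 17, so only faces of the cone are removed. *)
Definition cert_cone_base : seq (seq nat * option nat) :=
  [::
   ([:: 1; 2; 17; 18], Some 0); ([:: 0; 1; 17], Some 16); ([:: 0; 16; 17], Some 13);
   ([:: 1; 16; 17], Some 15); ([:: 15; 16; 17], Some 12); ([:: 16; 17], Some 14);
   ([:: 14; 17], Some 1); ([:: 1; 17], Some 13); ([:: 15; 17], Some 0);
   ([:: 12; 17], Some 0); ([:: 0; 2; 17; 18], Some 11); ([:: 0; 11; 17], Some 8);
   ([:: 8; 11; 17], Some 9); ([:: 9; 11; 17], Some 7); ([:: 11; 17], Some 10);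
   ([:: 9; 17], Some 2); ([:: 2; 17; 18], Some 8); ([:: 17], Some 0)].

(** The vertices removed with apex 17 lie outside [X], so all their faces are coned off. *)
Definition cert_cone_point : seq (seq nat * option nat) :=
  [::
   ([:: 13], Some 17); ([:: 8], Some 17); ([:: 16], Some 17); ([:: 7], Some 17);
   ([:: 12], Some 17); ([:: 11], Some 17); ([:: 15], Some 17); ([:: 10], Some 17);
   ([:: 14], Some 1); ([:: 17], Some 2); ([:: 0; 1], Some 2); ([:: 9], Some 2);
   ([:: 0; 2], Some 18); ([:: 0; 18], Some 6); ([:: 6; 18], Some 4); ([:: 4; 18], Some 3);
   ([:: 4; 6], Some 5); ([:: 4], Some 0); ([:: 0], Some 3); ([:: 5], Some 2);
   ([:: 6], Some 1); ([:: 2], Some 18); ([:: 1], Some 3); ([:: 3], Some 18)].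

Definition face_F : seq nat := [:: 0; 1; 2; 18].
Definition face_t : seq nat := [:: 1; 2; 18].
Definition face_s : seq nat := [:: 0; 2; 18].
Definition face_e : seq nat := [:: 0; 18].

Fixpoint subfaces (s : seq nat) : seq (seq nat) :=
  if s is x :: s' then [:: x] :: map (cons x) (subfaces s') ++ subfaces s' else [::].

Definition faces (fs : seq (seq nat)) : seq (seq nat) := undup (flatten (map subfaces fs)).

Definition list_C1 := faces facets_C1.
Definition list_C2 := faces facets_C2.
Definition list_X := faces facets_X.
Definition list_K := faces (face_F :: facets_C1 ++ facets_C2 ++ facets_X).
(** The faces of [list_K] come first, so that removing the others leaves literally this list, as
    [reduces] demands. *)
Definition list_cone :=
  list_K ++ [:: 17] :: map (face_ins 17 17) (faces (face_F :: facets_C1 ++ facets_C2)).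

Lemma reduces_110 : reduces 17 list_K cert_110 [:: [:: 18]].
Proof. by vm_compute. Qed.

Lemma reduces_011 : reduces 17 list_K cert_011 [:: [:: 18]].
Proof. by vm_compute. Qed.

Lemma reduces_cone_base : reduces 17 list_cone cert_cone_base list_K.
Proof. by vm_compute. Qed.

Lemma reduces_cone_point : reduces 17 list_cone cert_cone_point [:: [:: 18]].
Proof. by vm_compute. Qed.

Lemma closed_lists : [/\ closed_list 17 list_K, closed_list 17 list_C1,
  closed_list 17 list_C2, closed_list 17 list_X & closed_list 17 list_cone].
Proof. by split; vm_compute. Qed.

Lemma pieces_ok : piece_ok 17 face_F list_C1 /\ piece_ok 17 face_F list_C2.
Proof. by split; vm_compute. Qed.

Lemma X_ok : all (fun s => size s <= 3) list_X /\
  all (fun s => (size s == 2) ==> (s != face_e) ==> (1 < size (cofaces 17 list_X s))) list_X.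
Proof. by split; vm_compute. Qed.

Lemma K_ok : all (fun s => (size s <= 4) && ((size s == 4) ==>
  (s == face_F) || (s \in list_C1) || (s \in list_C2))) list_K.
Proof. by vm_compute. Qed.

Lemma sublists_ok :
  all (fun s => s \in list_K) (face_F :: list_C1 ++ list_C2 ++ list_X).
Proof. by vm_compute. Qed.

Lemma disjoint_ok :
  all (fun s => (2 < size s) ==> (s \notin list_C2) && (s \notin list_X)) list_C1 /\
  all (fun s => (2 < size s) ==> (s \notin list_X)) list_C2.
Proof. by split; vm_compute. Qed.

Lemma facets_F_ok :
  all (fun s => (2 < size s) && subface s face_F ==>
    (s \in [:: face_F; face_t; face_s]) || (s \in list_C2)) list_K.
Proof. by vm_compute. Qed.

Lemma special_ok : [/\ face_t \in list_X, face_s \in list_C1 & [:: 3; 4; 18] \in list_X].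
Proof. by split; vm_compute. Qed.

#[global] Opaque list_K list_C1 list_C2 list_X list_cone.

Lemma special_faces : [/\ apex_face 17 4 face_F, apex_face 17 3 face_t,
  apex_face 17 3 face_s, apex_face 17 2 face_e & apex_face 17 3 [:: 3; 4; 18]].
Proof. by []. Qed.

Lemma valid_data : valid_pieces 17 list_K list_C1 list_C2 list_X
  face_F face_t face_s face_e [:: 3; 4; 18].
Proof.
have [cK c1 c2 cX _] := closed_lists; have [p1 p2] := pieces_ok.
have [x1 x2] := X_ok; have [d1 d2] := disjoint_ok; have [t1 s1 y1] := special_ok.
have [f1 f2 f3 f4 f5] := special_faces.
exact: (ValidPieces cK c1 c2 cX p1 p2 x1 x2 K_ok sublists_ok d1 d2 facets_F_ok
  f1 (And3 f2 t1 _) (And3 f3 s1 _) (And3 f4 _ _) (And3 f5 y1 _)).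
Qed.

Lemma vector110E k : vector110 k.+3 =
  [seq (i == 0) + (i == 1 + k.+1) + (i == 0 + k.+1) | i <- iota 0 k.+4].
Proof. by rewrite indicator_vector /vector110 -[k.+3]addn3 addnK. Qed.

Lemma vector011E k : vector011 k.+3 =
  [seq (i == 0) + (i == 2 + k.+1) + (i == 1 + k.+1) | i <- iota 0 k.+4].
Proof. by rewrite indicator_vector /vector011 -[k.+3]addn3 addnK. Qed.

Lemma example_110 (R : realDomainType) k :
  optimal_morse_vector R (example 17 k list_K) (vector110 k.+3).
Proof.
have h : critical_of 17 k cert_110 =
  wtop 17 k [:: 1; 13; 18] |: (wtop 17 k [:: 4; 18] |: [set [set W0 17 k]]) by [].
have := example_optimal valid_data R reduces_110 h erefl erefl erefl erefl erefl.
by rewrite vector110E.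
Qed.

Lemma example_011 (R : realDomainType) k :
  optimal_morse_vector R (example 17 k list_K) (vector011 k.+3).
Proof.
have h : critical_of 17 k cert_011 =
  wtop 17 k [:: 0; 1; 2; 18] |: (wtop 17 k [:: 0; 8; 18] |: [set [set W0 17 k]]) by [].
have := example_optimal valid_data R reduces_011 h erefl erefl erefl erefl erefl.
by rewrite vector011E.
Qed.

(** * Contractibility *)

From mathcomp Require Import lra.
From mathcomp Require Import all_classical all_reals all_analysis.
Import Order.TTheory GRing.Theory Num.Theory numFieldNormedType.Exports.

Local Open Scope ring_scope.
Local Open Scope classical_set_scope.

Section Realizations.
Variables (V : finType) (R : realType).
Notation T := {ptws V -> R}.
Implicit Types (s r : {set V}) (K L : {set {set V}}) (x : {ptws V -> R}).

Lemma continuous_ptws (S : topologicalType) (f : S -> T) :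
  (forall u, continuous (fun y : S => f y u)) -> continuous f.
Proof.
move=> cf y; apply/cvg_sup => u.
exact: (@continuous_comp_initial _ _ _ (fun x : T => x u) f (cf u) y).
Qed.

Lemma continuous_coord (u : V) : continuous (fun x : T => x u).
Proof. exact: (@proj_continuous V (fun=> R) u). Qed.

Lemma continuous_prod (S A B : topologicalType) (f : S -> A) (g : S -> B) :
  continuous f -> continuous g -> continuous (fun y => (f y, g y)).
Proof. by move=> cf cg y; apply: cvg_pair; [exact: cf|exact: cg]. Qed.

Lemma fst_continuous (A B : topologicalType) : continuous (@fst A B).
Proof. by move=> z; apply: cvg_fst. Qed.

Lemma snd_continuous (A B : topologicalType) : continuous (@snd A B).
Proof. by move=> z; apply: cvg_snd. Qed.

Lemma continuous_min_cst (S : topologicalType) (a : R) (f : S -> R) :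
  continuous f -> continuous (fun y => Num.min a (f y)).
Proof.
move=> cf y; apply: (@continuous_min R S (fun=> a) f y); last exact: cf.
exact: cst_continuous.
Qed.

Lemma continuous_max_cst (S : topologicalType) (a : R) (f : S -> R) :
  continuous f -> continuous (fun y => Num.max a (f y)).
Proof.
move=> cf y; apply: (@continuous_max R S (fun=> a) f y); last exact: cf.
exact: cst_continuous.
Qed.

(** The default value [x i0] is harmless because [i0] is taken in [s]. *)
Definition min_coord (s : {set V}) (i0 : V) (x : T) : R :=
  \big[Num.min/x i0]_(i in s) x i.

Lemma continuous_min_coord s i0 : continuous (min_coord s i0).
Proof.
rewrite /min_coord => x; elim: (index_enum V) => [|i l IH].
  have -> : (fun x : T => \big[Num.min/x i0]_(i <- [::] | i \in s) x i) = (fun x : T => x i0).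
    by apply/funext => y; rewrite big_nil.
  exact: continuous_coord.
have -> : (fun x : T => \big[Num.min/x i0]_(i <- i :: l | i \in s) x i) =
  (fun x : T => if i \in s then Num.min (x i) (\big[Num.min/x i0]_(i <- l | i \in s) x i)
    else \big[Num.min/x i0]_(i <- l | i \in s) x i).
  by apply/funext => y; rewrite big_cons.
case: (i \in s) => //.
apply: (@continuous_min R T (fun x => x i)) => //; exact: continuous_coord.
Qed.

(* [push] moves a point away from the free face [s], towards the vertex [v], until some
   barycentric coordinate of [s] vanishes: the linear retraction of an elementary
   collapse. *)
Definition push_coeff (s : {set V}) (v u : V) : R :=
  if u \in s then -1 else if u == v then #|s|%:R else 0.

Definition push s i0 v (z : T * R) : T :=
  fun u => z.1 u + z.2 * min_coord s i0 z.1 * push_coeff s v u.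

Lemma continuous_push s i0 v : continuous (push s i0 v).
Proof.
apply: continuous_ptws => u z; rewrite /push.
apply: (@continuousD R R^o _ (fun z : T * R => z.1 u)).
  apply: (@continuous_comp _ _ _ fst (fun x : T => x u)).
    exact: fst_continuous.
  exact: continuous_coord.
apply: continuousM; last exact: cst_continuous.
apply: continuousM; first exact: snd_continuous.
apply: (@continuous_comp _ _ _ fst (min_coord s i0)); first exact: fst_continuous.
exact: continuous_min_coord.
Qed.


Lemma min_coord_le s i0 (x : T) i : i \in s -> min_coord s i0 x <= x i.
Proof. by move=> si; apply: bigmin_le_cond. Qed.

Lemma min_coord_attained (s : {set V}) i0 (x : T) : i0 \in s ->
  exists2 i, i \in s & min_coord s i0 x = x i.
Proof.
move=> si; rewrite /min_coord; elim/big_ind: _ => [|y z [i ii ->] [j jj ->]|i ii].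
- by exists i0.
- by rewrite /Num.min; case: ifP => _; [exists i|exists j].
- by exists i.
Qed.

(** Hence [push] preserves the sum of the barycentric coordinates. *)
Lemma sum_push_coeff (s : {set V}) v : v \notin s -> \sum_u push_coeff s v u = 0.
Proof.
move=> vs; rewrite (bigID (mem s)) /=.
have -> : \sum_(u in s) push_coeff s v u = - #|s|%:R.
  by rewrite (eq_bigr (fun=> -1)) ?sumr_const ?mulNrn // => u us; rewrite /push_coeff us.
have -> : \sum_(u | u \notin s) push_coeff s v u = #|s|%:R.
  rewrite (bigD1 v) //= big1 ?addr0 => [|u /andP[us uv]].
    by rewrite /push_coeff (negbTE vs) eqxx.
  by rewrite /push_coeff (negbTE us) (negbTE uv).
by rewrite addNr.
Qed.

Lemma push0 (s : {set V}) i0 v x c : min_coord s i0 x = 0 -> push s i0 v (x, c) = x.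
Proof.
by move=> m0; apply/funext => u; rewrite /push /= m0 mulr0 mul0r addr0.
Qed.

(** * The linear retraction of an elementary collapse *)

Section Retraction.

Variables (K : {set {set V}}) (s : {set V}) (i0 v : V).
Hypothesis cK : simplicial_complex K.
Hypothesis si0 : i0 \in s.
Hypothesis vs : v \notin s.
Hypothesis Kt : v |: s \in K.
Hypothesis free : forall r, r \in K -> s \subset r -> r = s \/ r = v |: s.

Let L := K :\: [set s; v |: s]%SET.

(** If no coordinate in [s] vanishes, the support contains [s], and freeness leaves only [s] and
    [v |: s]. *)
Lemma realization_min_coord (x : T) : realization R K x ->
  0 <= min_coord s i0 x /\
  (min_coord s i0 x != 0 -> forall u, u \notin v |: s -> x u = 0).
Proof.
move=> [x0 _ xK]; have [i si ei] := min_coord_attained x si0; split; first by rewrite ei.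
move=> m0; have ss : s \subset [set v | x v != 0]%SET.
  apply/fintype.subsetP => u us; rewrite inE; apply: contra m0 => /eqP xu.
  by rewrite eq_le ei -{1}ei -{1}xu min_coord_le //= x0.
move=> u; apply: contraNeq => xu.
have: u \in [set v | x v != 0]%SET by rewrite inE.
by case: (free xK ss) => -> // us; rewrite !inE us orbT.
Qed.

Lemma push_realization (x : T) c : realization R K x -> 0 <= c <= 1 ->
  realization R K (push s i0 v (x, c)).
Proof.
move=> xK /andP[c0 c1]; have [m0 mt] := realization_min_coord xK.
have [e|ne] := eqVneq (min_coord s i0 x) 0; first by rewrite push0.
have [x0 x1 _] := xK; have {}mt := mt ne.
have sum1 : \sum_u push s i0 v (x, c) u = 1.
  by rewrite /push /= big_split /= x1 -big_distrr /= sum_push_coeff // mulr0 addr0.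
split=> //.
- move=> u; rewrite /push /push_coeff /=; case: ifP => [us|_].
    rewrite mulrN1 subr_ge0; apply: le_trans (min_coord_le i0 x us).
    by rewrite ler_piMl.
  by case: ifP => _; rewrite ?mulr0 ?addr0 ?x0 // addr_ge0 ?x0 ?mulr_ge0 ?ler0n.
- case: cK => _ down; apply: down Kt _ _.
    apply/fintype.subsetP => u; rewrite inE; apply: contraNT => ut.
    rewrite /push /= mt // /push_coeff; move: ut; rewrite !inE negb_or.
    case/andP=> /negbTE-> /negbTE->.
    by rewrite mulr0 addr0.
  apply/eqP => e; move: sum1; rewrite big1 => [/eqP|u _]; first by rewrite eq_sym oner_eq0.
  apply/eqP; apply: contraT => nu.
  have : u \in [set w | push s i0 v (x, c) w != 0]%SET by rewrite inE.
  by rewrite e inE.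
Qed.

Lemma realization_collapse (x : T) : realization R K x ->
  (exists2 i, i \in s & x i = 0) -> realization R L x.
Proof.
move=> [x0 x1 xK] [i si xi]; split=> //; rewrite !inE xK andbT negb_or.
apply/andP; split; apply: contraTneq isT => /setP/(_ i); rewrite !inE si xi eqxx ?orbT.
  by [].
by [].
Qed.

Lemma push1_realization (x : T) : realization R K x -> realization R L (push s i0 v (x, 1)).
Proof.
move=> xK; apply: realization_collapse; first by apply: push_realization; rewrite // ler01 lexx.
have [i si ei] := min_coord_attained x si0; exists i => //.
by rewrite /push /push_coeff /= si ei mul1r mulrN1 subrr.
Qed.

Lemma realization_sub (x : T) : realization R L x -> realization R K x.
Proof. by move=> [x0 x1]; rewrite !inE => /andP[_ xK]. Qed.

Lemma push_id (x : T) c : realization R L x -> push s i0 v (x, c) = x.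
Proof.
move=> xL; apply: push0; have [m0 mt] := realization_min_coord (realization_sub xL).
apply/eqP; apply: contraT => ne; case: xL => x0 _; rewrite !inE negb_or => /andP[/andP[ns nt] xK].
have ss : s \subset [set v | x v != 0]%SET.
  apply/fintype.subsetP => u us; rewrite inE; apply: contra ne => /eqP xu.
  by rewrite eq_le m0 andbT -xu min_coord_le.
by case: (free xK ss) => e; rewrite e eqxx in ns nt.
Qed.

End Retraction.

(* Requiring [H (x, 0) = x] off [A] too lets homotopies be concatenated by
   composition, without gluing. *)
Definition global_contraction (A : set T) (P : T -> Prop) : Prop :=
  exists (a : T) (H : T * R -> T),
    [/\ A a, continuous H, forall x t, A x -> 0 <= t <= 1 -> A (H (x, t)),
       forall x, P x -> H (x, 0) = x & forall x, A x -> H (x, 1) = a].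

(** The first half of the time pushes onto [L], the second runs [H]; [min] and [max] hold each
    motion still during the other half. In the first half [H (x, 0) = x] is used off [L], whence the
    predicate [True]. *)
Lemma contraction_expand K L : simplicial_complex K -> elementary_collapse K L ->
  global_contraction (realization R L) (fun=> True) ->
  global_contraction (realization R K) (fun=> True).
Proof.
move=> cK /(elementary_collapse_vertex cK)[s [i0 [v [si0 vs Kt free eL]]]].
rewrite eL => -[a [H [La cH HL H0 H1]]].
exists a, (fun z => H (push s i0 v (z.1, Num.min 1 (2 * z.2)), Num.max 0 (2 * z.2 - 1))).
split=> //.
- exact: realization_sub La.
- have c2 : continuous (fun z : T * R => 2 * z.2 : R).
    move=> z; apply: (@continuousM R _ (fun=> 2) snd); first exact: cst_continuous.
    exact: snd_continuous.
  have cmin := @continuous_min_cst _ 1 _ c2.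
  have cmax : continuous (fun z : T * R => Num.max 0 (2 * z.2 - 1) : R).
    apply: continuous_max_cst => z.
    apply: (@continuousB R R^o _ (fun z : T * R => 2 * z.2)); first exact: c2.
    exact: cst_continuous.
  have cp : continuous (fun z : T * R => push s i0 v (z.1, Num.min 1 (2 * z.2))).
    pose g (z : T * R) := (z.1, Num.min 1 (2 * z.2)).
    move=> z; apply: (@continuous_comp _ _ _ g); last exact: continuous_push.
    by apply: continuous_prod => //; exact: fst_continuous.
  pose g (z : T * R) := (push s i0 v (z.1, Num.min 1 (2 * z.2)), Num.max 0 (2 * z.2 - 1)).
  move=> z; apply: (@continuous_comp _ _ _ g); last exact: cH.
  exact: continuous_prod.
- move=> x t xK /andP[t0 t1] /=; have [h|h] := leP (2 * t) 1.
    have -> : Num.max 0 (2 * t - 1) = 0 :> R by apply/max_idPl; lra.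
    by rewrite H0 //; apply: push_realization => //; lra.
  apply: (@realization_sub K s v); apply: HL; last first.
    have -> : Num.max 0 (2 * t - 1) = 2 * t - 1 :> R by apply/max_idPr; lra.
    lra.
  exact: push1_realization.
- move=> x _ /=; rewrite mulr0 sub0r.
  have -> : Num.max 0 (-1) = 0 :> R by apply/max_idPl; lra.
  have -> : Num.min 1 0 = 0 :> R by apply/min_idPr; lra.
  by rewrite H0 //; apply/funext => u; rewrite /push /= !mul0r addr0.
- move=> x xK /=; rewrite mulr1.
  have -> : 2 - 1 = 1 :> R by lra.
  have -> : Num.max 0 1 = 1 :> R by apply/max_idPr; lra.
  have -> : Num.min 1 2 = 1 :> R by apply/min_idPl; lra.
  by rewrite H1 //; apply: push1_realization.
Qed.

(** A retract of a contractible space is contractible: [H] is followed by the retraction, which is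
    the identity only on [L], so the predicate shrinks. *)
Lemma contraction_retract K L : simplicial_complex K -> elementary_collapse K L ->
  global_contraction (realization R K) (realization R K) ->
  global_contraction (realization R L) (realization R L).
Proof.
move=> cK /(elementary_collapse_vertex cK)[s [i0 [v [si0 vs Kt free eL]]]].
rewrite eL => -[a [H [Ka cH HK H0 H1]]].
exists (push s i0 v (a, 1)), (fun z => push s i0 v (H z, 1)); split.
- exact: push1_realization.
- move=> z; apply: (@continuous_comp _ _ _ (fun z : T * R => (H z, 1 : R)));
    last exact: continuous_push.
  by apply: continuous_prod => //; exact: cst_continuous.
- by move=> x t /(@realization_sub K s v) xK t01; apply: push1_realization => //; apply: HK.
- by move=> x xL; rewrite H0; [exact: push_id xL|exact: realization_sub xL].
- by move=> x /(@realization_sub K s v) xK; rewrite H1.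
Qed.

Lemma connect_contraction_expand K L : simplicial_complex K ->
  connect (@elementary_collapse V) K L ->
  global_contraction (realization R L) (fun=> True) ->
  global_contraction (realization R K) (fun=> True).
Proof.
move=> cK /connectP[p]; elim: p K cK => [|K' p IH] K cK /= => [_ -> //|].
case/andP=> KK' pp eL hL; apply: (contraction_expand cK KK').
exact: IH (elementary_collapse_complex cK KK') pp eL hL.
Qed.

Lemma connect_contraction_retract K L : simplicial_complex K ->
  connect (@elementary_collapse V) K L ->
  global_contraction (realization R K) (realization R K) ->
  global_contraction (realization R L) (realization R L).
Proof.
move=> cK /connectP[p]; elim: p K cK => [|K' p IH] K cK /= => [_ -> //|].
case/andP=> KK' pp eL hK; apply: IH pp eL _.
  exact: elementary_collapse_complex cK KK'.
exact: contraction_retract cK KK' hK.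
Qed.

Lemma point_contraction (w : V) :
  global_contraction (realization R [set [set w]]%SET) (fun=> True).
Proof.
pose a : T := fun u => (u == w)%:R.
have sa : [set u | a u != 0]%SET = [set w]%SET.
  apply/finset.setP => u; rewrite !inE /a; case: (u == w); rewrite ?oner_eq0 //.
  by rewrite eqxx.
have ra : realization R [set [set w]]%SET a.
  split=> [u||]; rewrite /a ?ler0n ?sa ?inE //.
  by rewrite (bigD1 w) //= eqxx big1 ?addr0 // => u /negbTE->.
exists a, fst; split=> //; first exact: fst_continuous.
move=> x [x0 x1]; rewrite inE => /eqP ex; apply/funext => u.
have nz j : j != w -> x j = 0.
  move=> jw; apply/eqP; apply: contraT => xj.
  have : j \in [set v | x v != 0]%SET by rewrite inE.
  by rewrite ex inE (negbTE jw).
rewrite /a /=; have [->|uw] := eqVneq u w; last exact: nz.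
by move: x1; rewrite (bigD1 w) //= big1 ?addr0 // => j /nz.
Qed.

Lemma contractible_global (A : set T) : global_contraction A A -> contractible R A.
Proof.
move=> [a [H [Aa cH HA H0 H1]]]; exists a, H; split=> //.
exact: continuous_subspaceT.
Qed.

(** The contraction is built up from the point [w] to [L], then carried down to [K] by
    retractions. *)
Lemma contractible_zigzag K L (w : V) : simplicial_complex L ->
  connect (@elementary_collapse V) L K ->
  connect (@elementary_collapse V) L [set [set w]]%SET ->
  contractible R (realization R K).
Proof.
move=> cL LK Lw; apply/contractible_global/(connect_contraction_retract cL LK).
have [a [H [La cH HL H0 H1]]] := connect_contraction_expand cL Lw (point_contraction w).
by exists a, H; split=> // x _; apply: H0.
Qed.

End Realizations.

Theorem theorem3p3 (R : realType) (d : nat) (hd : (3 <= d)%N) :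
  exists (V : finType) (K : {set {set V}}),
    [/\ simplicial_complex K, complex_dim K = d,
        contractible R (realization R K) & ~ collapsible K] /\
    [/\ optimal_morse_vector R K (vector110 d),
        optimal_morse_vector R K (vector011 d)
      & vector110 d <> vector011 d].
Proof.
(* The base has dimension 3, and a wedge with [k.+1] new vertices adds [k]. *)
case: d hd => [|[|[|k]]] // _; exists (wvertex 17 k), (example 17 k list_K).
split; split.
- exact: example_complex valid_data.
- exact: example_dim valid_data.
- have [_ _ _ _ cone_closed] := closed_lists.
  have cone_complex := wedge_complex k cone_closed.
  apply: (@contractible_zigzag _ R (example 17 k list_K) _ (W0 17 k) cone_complex).
    exact: (@reduces_collapse 17 k _ cert_cone_base _ isT reduces_cone_base).
  apply: connect_trans (wedge_point_collapse 17 k).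
  exact: (@reduces_collapse 17 k _ cert_cone_point _ isT reduces_cone_point).
- exact: example_not_collapsible valid_data.
- exact: example_110.
- exact: example_011.
- by move/eqP; rewrite /vector110 /vector011 eqseq_cons eqseq_cat // andbF.
Qed.
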